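(* Let $X\subset\mathbb{CP}^N$ be a projective algebraic surface of degree $8$ admitting a projective degeneration into a union of $8$ planes whose shadow is the complex $X^3$ described in the context, and let $X_{\mathrm{Gal}}$ be the Galois cover of $X$ with respect to a generic projection $X\to\mathbb{CP}^2$. Then the fundamental group $\pi_1(X_{\mathrm{Gal}})$ is trivial.
   Context: **Degeneration and shadow.** A generic projection $p':X_0\to\mathbb{CP}^2$ is a projective degeneration of a generic projection $p:Y\to\mathbb{CP}^2$ if there are a flat family $\pi:V\to\Delta$ over the unit disc and a map $F:V\to\Delta\times\mathbb{CP}^2$ (called an embedding in the source) whose composition with the first projection is $\pi$, such that $\pi^{-1}(0)\simeq X_0$, $\pi^{-1}(t_0)\simeq Y$ for some $t_0\neq0$, the family is smooth over $\Delta\setminus\{0\}$, and $F$ restricts to $0\times p'$ on $\pi^{-1}(0)$ and to $t_0\times p$ on $\pi^{-1}(t_0)$. Here the degenerate fibre is a union of planes ($\cong\mathbb{CP}^2$), with only two planes meeting along any line. The shadow of the degeneration is the 2-dimensional complex with one triangle for each plane; two triangles share an edge (resp. a vertex) if the corresponding planes meet in a line (resp. a point). An edge belonging to a single triangle is redundant; only non-redundant edges are numbered $1,\dots,q$. The multiplicity of a vertex is the number of non-redundant edges at it. **Shadow $X^3$.** Vertices $V_1,\dots,V_6$; triangles $V_1V_6V_5$, $V_1V_5V_3$, $V_1V_3V_2$, $V_1V_2V_6$, $V_4V_5V_3$, $V_4V_5V_6$, $V_4V_6V_2$, $V_4V_2V_3$, where the edge joining $V_5,V_6$ in the triangle $V_1V_6V_5$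 and the edge joining $V_5,V_6$ in the triangle $V_4V_5V_6$ are two different (redundant) edges, not glued. The $q=11$ non-redundant edges are $1=V_1V_6$, $2=V_1V_5$, $3=V_1V_2$, $4=V_1V_3$, $5=V_3V_5$, $6=V_2V_3$, $7=V_3V_4$, $8=V_2V_6$, $9=V_4V_5$, $10=V_2V_4$, $11=V_4V_6$. **Galois cover.** For a generic projection $f:X\to\mathbb{CP}^2$ of degree $n$ (here $n=8$), $X_{\mathrm{Gal}}=\overline{(X\times_{\mathbb{CP}^2}\cdots\times_{\mathbb{CP}^2}X)\setminus\triangle}$ ($n$ factors), where $\triangle$ is the extended diagonal $\{(x_1,\dots,x_n): x_i=x_j \text{ for some } i\ne j\}$. Let $S\subset\mathbb{CP}^2$ be the branch curve of $f$ and $G=\pi_1(\mathbb{CP}^2\setminus S)$. The group $G$ is generated by $\gamma_i,\gamma_{i'}$ ($1\le i\le q$). There is an exact sequence $$1\to\pi_1(X_{\mathrm{Gal}})\to G/\langle\langle\gamma^2\rangle\rangle\to S_n\to1,$$ where $\langle\langle\gamma^2\rangle\rangle$ is the normal subgroup generated by all $\gamma_i^2,\gamma_{i'}^2$, and $\gamma_i,\gamma_{i'}$ both map to the transposition exchanging the two triangles that share edge $i$. **Presentation of $G$ (the standard Van Kampen presentation from the regeneration technique).** Write $[x,y]=xyx^{-1}y^{-1}$ and $\langle x,y\rangle=xyxy^{-1}x^{-1}y^{-1}$. The group $G$ is presented on the generators above with the following relations. (R4) For each $(i,j,k,l)\in\{(1,2,3,4),(3,6,8,10),(4,5,6,7),(7,9,10,11)\}$,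 writing $a,a',b,b',c,c',d,d'$ for $\gamma_i,\gamma_{i'},\gamma_j,\gamma_{j'},\gamma_k,\gamma_{k'},\gamma_l,\gamma_{l'}$: - $\langle a',b\rangle=\langle a',b'\rangle=\langle a',b^{-1}b'b\rangle=e$; - $\langle c,d\rangle=\langle c',d\rangle=\langle c^{-1}c'c,d\rangle=e$; - $[b'ba'b^{-1}b'^{-1},d]=e$; - $[b'ba'b^{-1}b'^{-1},c^{-1}c'^{-1}d^{-1}d'dc'c]=e$; - $\langle a,b\rangle=\langle a,b'\rangle=\langle a,b^{-1}b'b\rangle=e$; - $\langle c,d^{-1}d'd\rangle=\langle c',d^{-1}d'd\rangle=\langle c^{-1}c'c,d^{-1}d'd\rangle=e$; - $[b'bab^{-1}b'^{-1},d^{-1}d'd]=e$; - $[b'bab^{-1}b'^{-1},c^{-1}c'^{-1}d^{-1}d'^{-1}dd'dc'c]=e$; - $b'ba'ba'^{-1}b^{-1}b'^{-1}=dc'd^{-1}$; - $b'ba'b'a'^{-1}b^{-1}b'^{-1}=dc'cc'^{-1}d^{-1}$; - $b'baba^{-1}b^{-1}b'^{-1}=d^{-1}d'dc'd^{-1}d'^{-1}d$; - $b'bab'a^{-1}b^{-1}b'^{-1}=d^{-1}d'dc'cc'^{-1}d^{-1}d'^{-1}d$. (R3) For each $(i,j,k)\in\{(2,5,9),(1,8,11)\}$, writing $a,a',b,b',c,c'$ for $\gamma_i,\gamma_{i'},\gamma_j,\gamma_{j'},\gamma_k,\gamma_{k'}$: - $\langle a',b\rangle=\langle a',b'\rangle=\langle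 a',b^{-1}b'b\rangle=e$; - $a=b'ba'b^{-1}b'^{-1}$; - $\langle c,b'ba'ba'^{-1}b^{-1}b'^{-1}\rangle=\langle c,b'ba'b'a'^{-1}b^{-1}b'^{-1}\rangle=\langle c,b'ba'b^{-1}b'ba'^{-1}b^{-1}b'^{-1}\rangle=e$; - $c'=c\,b'ba'b'ba'^{-1}b^{-1}b'^{-1}\,c\,b'ba'b^{-1}b'^{-1}a'^{-1}b^{-1}b'^{-1}\,c^{-1}$; - $[a,c]=[a,c']=[a',c]=[a',c']=e$. (R5) $[x,y]=e$ for all $x\in\{\gamma_i,\gamma_{i'}\}$, $y\in\{\gamma_j,\gamma_{j'}\}$, whenever edges $i,j$ have no common vertex, i.e. $(i,j)\in(\{1\}\times\{5,6,7,9,10\})\cup(\{2\}\times\{6,7,8,10,11\})\cup(\{3\}\times\{5,7,9,11\})\cup(\{4\}\times\{9\})\cup(\{4,5\}\times\{8,10,11\})\cup(\{6\}\times\{9,11\})\cup(\{8\}\times\{7,9\})$. (RP) $\gamma_{11'}\gamma_{11}\gamma_{10'}\gamma_{10}\cdots\gamma_{1'}\gamma_1=e$. *)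

(* Defs.v *)
From HB Require Import structures.
From mathcomp Require Import all_boot all_order all_fingroup all_algebra.
From mathcomp Require Import complex.
From mathcomp Require Import all_classical all_reals all_analysis.
From mathcomp Require Import ring lra.
(* not imported: the notations of mpoly clash with those of analysis *)
From mathcomp Require mpoly.

Import Order.TTheory GRing.Theory Num.Theory numFieldNormedType.Exports.

Set Implicit Arguments.
Unset Strict Implicit.
Unset Printing Implicit Defensive.

Local Open Scope quotient_scope.
Local Open Scope classical_set_scope.
Local Open Scope ring_scope.

Local Ltac minmax := repeat match goal with
  | |- context [Order.min ?a ?b] =>
      lazymatch b with context [Order.min _ _] => fail | _ => case: (leP a b) => ? end
  | |- context [Order.max ?a ?b] => case: (leP a b) => ?
  end; lra.

(* The fundamental group of T at x: loops are functions on R of which only the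
   restriction to [0, 1] matters. *)
Section FundamentalGroup.
Context {R : realType} {T : topologicalType}.
Implicit Types (x : T) (f g h : R -> T).

Local Notation I := (`[0, 1]%classic : set R).
Local Notation II := (`[0, 1]%classic `*` `[0, 1]%classic : set (R * R)).

Definition is_loop x f := [/\ {within I, continuous f}, f 0 = x & f 1 = x].

Definition homotopic x f g := exists H : R * R -> T,
  [/\ {within II, continuous H},
      forall t, I t -> H (t, 0) = f t /\ H (t, 1) = g t
    & forall s, I s -> H (0, s) = x /\ H (1, s) = x].

Definition concat f g : R -> T :=
  fun t => if t <= 2^-1 then f (2 * t) else g (2 * t - 1).

Definition reverse f : R -> T := fun t => f (1 - t).

Local Lemma within_comp {S Z : topologicalType} (D : set S) (B : set Z)
    (f : Z -> T) (s : S -> Z) :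
  continuous s -> (forall y, D y -> B (s y)) ->
  {within B, continuous f} -> {within D, continuous (f \o s)}.
Proof.
move=> cs sDB cf; apply/subspace_continuousP => y Dy W /= nW.
have /subspace_continuousP /(_ _ (sDB _ Dy)) /(_ _ nW) := cf.
rewrite /= /nbhs /= /within /= => nV.
have := cs y _ nV; rewrite /= /nbhs /=.
by apply: filterS => z /= h /sDB; exact: h.
Qed.

Local Lemma paste {S : topologicalType} (D : set S) (c : S -> R) (u v : S -> T) :
  closed D -> continuous c ->
  {within D `&` [set y | c y <= 2^-1], continuous u} ->
  {within D `&` [set y | 2^-1 <= c y], continuous v} ->
  (forall y, D y -> c y = 2^-1 -> u y = v y) ->
  {within D, continuous (fun y => if c y <= 2^-1 then u y else v y)}.
Proof.
move=> cD cc cu cv uv.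
have -> : D = (D `&` [set y | c y <= 2^-1]) `|` (D `&` [set y | 2^-1 <= c y]).
  rewrite -setIUr; apply/seteqP; split => [y Dy|y []//]; split => //=.
  by have [|/ltW] := leP (c y) 2^-1; [left|right].
have cl1 : closed [set y | c y <= 2^-1].
  by apply: (closed_comp (f := c) (D := [set r | r <= 2^-1])) => [y _|]; [exact: cc|exact: closed_le].
have cl2 : closed [set y | 2^-1 <= c y].
  by apply: (closed_comp (f := c) (D := [set r | 2^-1 <= r])) => [y _|]; [exact: cc|exact: closed_ge].
apply: withinU_continuous; [exact: closedI|exact: closedI| |].
- apply: subspace_eq_continuous cu => y; rewrite inE /from_subspace /=.
  by move=> [_ ->].
- apply: subspace_eq_continuous cv => y; rewrite inE /from_subspace /=.
  move=> [Dy h].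
  by case: ifPn => // h'; rewrite -uv //; apply/eqP; rewrite eq_le h h'.
Qed.

Local Lemma itv0 : I 0. Proof. by rewrite /= in_itv /= lexx ler01. Qed.
Local Lemma itv1 : I 1. Proof. by rewrite /= in_itv /= lexx ler01. Qed.

Local Lemma closedII : closed II.
Proof.
rewrite (_ : II = fst @^-1` I `&` snd @^-1` I); last by apply/seteqP; split.
by apply: closedI; apply: closed_comp;
  [move=> ? _; exact: cvg_fst|exact: itv_closed
  |move=> ? _; exact: cvg_snd|exact: itv_closed].
Qed.

Local Lemma cpair (u v : R * R -> R) :
  continuous u -> continuous v -> continuous (fun z => (u z, v z)).
Proof. by move=> cu cv y; exact: (cvg_pair (cu y) (cv y)). Qed.

Local Lemma is_loop_cst x : is_loop x (fun=> x).
Proof. by split => //; apply: continuous_subspaceT => y; exact: cvg_cst. Qed.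

Local Lemma is_loop_concat x f g :
  is_loop x f -> is_loop x g -> is_loop x (concat f g).
Proof.
move=> [cf f0 f1] [cg g0 g1].
have mul2 : continuous (fun t : R => 2 * t).
  by move=> y; apply: cvgM; [exact: cvg_cst|exact: cvg_id].
split.
- apply: (paste (c := id)).
  + exact: itv_closed.
  + by move=> y; exact: cvg_id.
  + refine (@within_comp R R _ _ _ (fun t => 2 * t) _ _ cf); first exact: mul2.
    by move=> y /=; rewrite !in_itv /= => -[] /andP[? ?] ?; lra.
  + refine (@within_comp R R _ _ _ (fun t => 2 * t - 1) _ _ cg).
      by move=> y; apply: cvgB; [exact: mul2|exact: cvg_cst].
    by move=> y /=; rewrite !in_itv /= => -[] /andP[? ?] ?; lra.
  + by move=> y _ ->; rewrite mulfV// subrr f1 g0.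
- by rewrite /concat invr_ge0 ler0n mulr0.
- rewrite /concat ifN; first by rewrite mulr1 (_ : 2 - 1 = 1)//; ring.
  by rewrite -ltNge; lra.
Qed.

Local Lemma is_loop_reverse x f : is_loop x f -> is_loop x (reverse f).
Proof.
move=> [cf f0 f1]; split; last 2 first.
- by rewrite /reverse subr0.
- by rewrite /reverse subrr.
refine (@within_comp R R _ _ _ (fun t => 1 - t) _ _ cf).
  by move=> y; apply: cvgB; [exact: cvg_cst|exact: cvg_id].
by move=> y /=; rewrite !in_itv /= => /andP[? ?]; lra.
Qed.

Local Lemma homotopic_refl x f : is_loop x f -> homotopic x f f.
Proof.
move=> [cf f0 f1]; exists (f \o fst); split => //=.
refine (@within_comp (R * R)%type _ _ _ _ fst _ _ cf); last by move=> y [].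
by move=> y; exact: cvg_fst.
Qed.

Local Lemma homotopic_sym x f g : homotopic x f g -> homotopic x g f.
Proof.
move=> [H [cH H01 Hx]]; exists (fun z => H (z.1, 1 - z.2)); split => /=.
- refine (@within_comp (R * R)%type _ _ _ _ (fun z : R * R => (z.1, 1 - z.2)) _ _ cH).
    apply: cpair => y; first exact: cvg_fst.
    by apply: cvgB; [exact: cvg_cst|exact: cvg_snd].
  by move=> y /=; rewrite !in_itv /= => -[] /andP[? ?] /andP[? ?]; split; lra.
- by move=> t /H01; rewrite subr0 subrr => -[].
- move=> s; rewrite in_itv /= => /andP[? ?]; apply: Hx.
  by rewrite /= in_itv /=; lra.
Qed.

Local Lemma homotopic_trans x f g h :
  homotopic x f g -> homotopic x g h -> homotopic x f h.
Proof.
move=> [H [cH H01 Hx]] [K [cK K01 Kx]].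
exists (fun z => if z.2 <= 2^-1 then H (z.1, 2 * z.2) else K (z.1, 2 * z.2 - 1)).
have c2 : continuous (fun z : R * R => 2 * z.2).
  by move=> y; apply: cvgM; [exact: cvg_cst|exact: cvg_snd].
split => /=.
- apply: (paste (c := snd)).
  + exact: closedII.
  + by move=> y; exact: cvg_snd.
  + refine (@within_comp (R * R)%type _ _ _ _ (fun z : R * R => (z.1, 2 * z.2)) _ _ cH).
      by apply: cpair => y; [exact: cvg_fst|exact: c2].
    move=> y /=; rewrite !in_itv /= => -[] [] /andP[? ?] /andP[? ?] ?; split; lra.
  + refine (@within_comp (R * R)%type _ _ _ _ (fun z : R * R => (z.1, 2 * z.2 - 1)) _ _ cK).
      apply: cpair => y; first exact: cvg_fst.
      by apply: cvgB; [exact: c2|exact: cvg_cst].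
    move=> y /=; rewrite !in_itv /= => -[] [] /andP[? ?] /andP[? ?] ?; split; lra.
  + move=> y [Iy _] ->; rewrite mulfV// subrr.
    by have [_ ->] := H01 _ Iy; have [-> _] := K01 _ Iy.
- move=> t It; rewrite invr_ge0 ler0n mulr0 ifN; last by rewrite -ltNge; lra.
  rewrite mulr1 (_ : 2 - 1 = 1); last by ring.
  by have [-> _] := H01 _ It; have [_ ->] := K01 _ It.
- move=> s; rewrite in_itv /= => /andP[? ?]; case: ifPn => s2.
    by apply: Hx; rewrite /= in_itv /=; lra.
  by apply: Kx; rewrite /= in_itv /=; move: s2; rewrite -ltNge; lra.
Qed.

Local Lemma homotopic_concat x f f' g g' :
  homotopic x f f' -> homotopic x g g' ->
  homotopic x (concat f g) (concat f' g').
Proof.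
move=> [H [cH H01 Hx]] [K [cK K01 Kx]].
exists (fun z => if z.1 <= 2^-1 then H (2 * z.1, z.2) else K (2 * z.1 - 1, z.2)).
have c2 : continuous (fun z : R * R => 2 * z.1).
  by move=> y; apply: cvgM; [exact: cvg_cst|exact: cvg_fst].
split => /=.
- apply: (paste (c := fst)).
  + exact: closedII.
  + by move=> y; exact: cvg_fst.
  + refine (@within_comp (R * R)%type _ _ _ _ (fun z : R * R => (2 * z.1, z.2)) _ _ cH).
      by apply: cpair => y; [exact: c2|exact: cvg_snd].
    move=> y /=; rewrite !in_itv /= => -[] [] /andP[? ?] /andP[? ?] ?; split; lra.
  + refine (@within_comp (R * R)%type _ _ _ _ (fun z : R * R => (2 * z.1 - 1, z.2)) _ _ cK).
      apply: cpair => y; last exact: cvg_snd.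
      by apply: cvgB; [exact: c2|exact: cvg_cst].
    move=> y /=; rewrite !in_itv /= => -[] [] /andP[? ?] /andP[? ?] ?; split; lra.
  + move=> y [_ Iy] ->; rewrite mulfV// subrr.
    by have [_ ->] := Hx _ Iy; have [-> _] := Kx _ Iy.
- move=> t; rewrite in_itv /= => /andP[? ?]; rewrite /concat; case: ifPn => t2.
    by apply: H01; rewrite /= in_itv /=; lra.
  by apply: K01; rewrite /= in_itv /=; move: t2; rewrite -ltNge; lra.
- move=> s Is; rewrite invr_ge0 ler0n mulr0 ifN; last by rewrite -ltNge; lra.
  rewrite mulr1 (_ : 2 - 1 = 1); last by ring.
  by have [-> _] := Hx _ Is; have [_ ->] := Kx _ Is.
Qed.

Local Lemma homotopic_reverse x f g :
  homotopic x f g -> homotopic x (reverse f) (reverse g).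
Proof.
move=> [H [cH H01 Hx]]; exists (fun z => H (1 - z.1, z.2)); split => /=.
- refine (@within_comp (R * R)%type _ _ _ _ (fun z : R * R => (1 - z.1, z.2)) _ _ cH).
    apply: cpair => y; last exact: cvg_snd.
    by apply: cvgB; [exact: cvg_cst|exact: cvg_fst].
  by move=> y /=; rewrite !in_itv /= => -[] /andP[? ?] /andP[? ?]; split; lra.
- move=> t; rewrite in_itv /= => /andP[? ?]; apply: H01.
  by rewrite /= in_itv /=; lra.
- by move=> s /Hx [h0 h1]; rewrite subr0 subrr.
Qed.

Local Lemma reparam x f (s t : R -> R) (u v : R -> T) :
  is_loop x f -> continuous s -> continuous t ->
  (forall r, I r -> I (s r)) -> (forall r, I r -> I (t r)) ->
  s 0 = t 0 -> s 1 = t 1 -> f (s 0) = x -> f (s 1) = x ->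
  (forall r, I r -> u r = f (s r)) -> (forall r, I r -> v r = f (t r)) ->
  homotopic x u v.
Proof.
move=> [cf _ _] cs ct sI tI s0 s1 fs0 fs1 us vt.
exists (fun z => f ((1 - z.2) * s z.1 + z.2 * t z.1)); split => /=.
- refine (@within_comp (R * R)%type _ _ _ _ (fun z : R * R => (1 - z.2) * s z.1 + z.2 * t z.1) _ _ cf).
    have cfst (w : R -> R) : continuous w -> continuous (fun z : R * R => w z.1).
      by move=> cw y; apply: continuous_comp; [exact: cvg_fst|exact: cw].
    move=> y; apply: cvgD; apply: cvgM.
    + by apply: cvgB; [exact: cvg_cst|exact: cvg_snd].
    + exact: cfst.
    + exact: cvg_snd.
    + exact: cfst.
  move=> y /= [/[dup] /sI + /tI]; rewrite /= !in_itv /=.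
  by move=> /andP[? ?] /andP[? ?] /andP[? ?]; apply/andP; split; nra.
- move=> r Ir; rewrite us// vt//; split; congr f; ring.
- move=> r Ir; split; [rewrite -s0 -[RHS]fs0|rewrite -s1 -[RHS]fs1];
    congr f; ring.
Qed.

Definition loop x := {f : R -> T | is_loop x f}.
HB.instance Definition _ x := gen_eqMixin (loop x).
HB.instance Definition _ x := gen_choiceMixin (loop x).

Definition loop_rel x : rel (loop x) :=
  fun f g : loop x => `[< homotopic x (sval f) (sval g) >].

Local Lemma loop_rel_refl x : reflexive (@loop_rel x).
Proof. by move=> [f ?]; apply/asboolP; exact: homotopic_refl. Qed.

Local Lemma loop_rel_sym x : symmetric (@loop_rel x).
Proof. by move=> f g; apply/asboolP/asboolP; exact: homotopic_sym. Qed.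

Local Lemma loop_rel_trans x : transitive (@loop_rel x).
Proof.
move=> g f h /asboolP fg /asboolP gh; apply/asboolP.
exact: homotopic_trans fg gh.
Qed.

Canonical loop_equiv x := EquivRel (@loop_rel x) (@loop_rel_refl x)
  (@loop_rel_sym x) (@loop_rel_trans x).

Definition pi1 x : Type := {eq_quot loop_equiv x}.
HB.instance Definition _ x := Choice.on (pi1 x).
HB.instance Definition _ x := EqQuotient.on (pi1 x).

Definition loop_one x : loop x := exist _ _ (is_loop_cst x).
Definition loop_mul x (f g : loop x) : loop x :=
  exist _ _ (is_loop_concat (svalP f) (svalP g)).
Definition loop_inv x (f : loop x) : loop x :=
  exist _ _ (is_loop_reverse (svalP f)).

Definition pi1_one x : pi1 x := \pi_(pi1 x) (loop_one x).
Definition pi1_mul x (a b : pi1 x) : pi1 x := \pi_(pi1 x) (loop_mul (generic_quotient.repr a) (generic_quotient.repr b)).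
Definition pi1_inv x (a : pi1 x) : pi1 x := \pi_(pi1 x) (loop_inv (generic_quotient.repr a)).

Local Lemma pi1P x (f g : loop x) :
  homotopic x (sval f) (sval g) -> \pi_(pi1 x) f = \pi_(pi1 x) g.
Proof. by move=> fg; apply/eqmodP/asboolP. Qed.

Local Lemma repr_homotopic x (f : loop x) :
  homotopic x (sval (generic_quotient.repr (\pi_(pi1 x) f))) (sval f).
Proof.
by have /eqmodP /asboolP := reprK (\pi_(pi1 x) f).
Qed.

Local Lemma pi1_mulE x (f g : loop x) :
  pi1_mul (\pi_(pi1 x) f) (\pi_(pi1 x) g) = \pi_(pi1 x) (loop_mul f g).
Proof. by apply: pi1P; apply: homotopic_concat; exact: repr_homotopic. Qed.

Local Lemma pi1_invE x (f : loop x) : pi1_inv (\pi_(pi1 x) f) = \pi_(pi1 x) (loop_inv f).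
Proof. by apply: pi1P; apply: homotopic_reverse; exact: repr_homotopic. Qed.

Local Lemma caffine (a b : R) : continuous (fun t : R => a * t + b).
Proof.
move=> y; apply: cvgD; last exact: cvg_cst.
by apply: cvgM; [exact: cvg_cst|exact: cvg_id].
Qed.

Local Lemma cmin (u v : R -> R) :
  continuous u -> continuous v -> continuous (fun t => Num.min (u t) (v t)).
Proof. by move=> cu cv y; apply: continuous_min; [exact: cu|exact: cv]. Qed.

Local Lemma cmax (u v : R -> R) :
  continuous u -> continuous v -> continuous (fun t => Num.max (u t) (v t)).
Proof. by move=> cu cv y; apply: continuous_max; [exact: cu|exact: cv]. Qed.

Local Lemma pi1_mulA x : associative (@pi1_mul x).
Proof.
elim/quotW => f; elim/quotW => g; elim/quotW => h.
rewrite (pi1_mulE g h) (pi1_mulE f g) !pi1_mulE; apply: pi1P => /=.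
case: f g h => [f lf] [g lg] [h lh] /=.
have [_ f0 _] := lf; have [_ _ h1] := lh.
pose s t : R := Num.min (2 * t + 0) (Num.min (1 * t + 4^-1) (2^-1 * t + 2^-1)).
apply: (@reparam x (concat f (concat g h)) id s) => //.
- exact/is_loop_concat/is_loop_concat.
- by move=> y; exact: cvg_id.
- by apply: cmin; [exact: caffine|apply: cmin; exact: caffine].
- move=> r /=; rewrite !in_itv /= /s => /andP[? ?].
  by rewrite !le_min !ge_min; apply/andP; split; lra.
- by rewrite /s; minmax.
- by rewrite /s; minmax.
- by rewrite /concat invr_ge0 ler0n mulr0.
- rewrite /concat; do 2 (rewrite ifN; last by rewrite -ltNge; lra).
  by rewrite -[RHS]h1; congr h; ring.
- move=> r _; rewrite /concat /s.
  have [r1|r1] := leP r (2^-1).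
    have [r2|r2] := leP (2 * r) 2^-1.
      have -> : Num.min (2 * r + 0) (Num.min (1 * r + 4^-1) (2^-1 * r + 2^-1)) = 2 * r.
        by minmax.
      by rewrite r2.
    have -> : Num.min (2 * r + 0) (Num.min (1 * r + 4^-1) (2^-1 * r + 2^-1)) = r + 4^-1.
      by minmax.
    rewrite ifN; last by rewrite -ltNge; lra.
    rewrite ifT; last by lra.
    by congr g; field.
  have -> : Num.min (2 * r + 0) (Num.min (1 * r + 4^-1) (2^-1 * r + 2^-1)) = 2^-1 * r + 2^-1.
    by minmax.
  do 2 (rewrite ifN; last by rewrite -ltNge; lra).
  by congr h; field.
Qed.

Local Lemma pi1_mul1 x : left_id (pi1_one x) (@pi1_mul x).
Proof.
elim/quotW => f; rewrite /pi1_one pi1_mulE; apply: pi1P.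
case: f => f lf /=; have [_ f0 f1] := lf.
apply: (@reparam x f (fun t => Num.max (0 * t + 0) (2 * t + -1)) id) => //.
- by apply: cmax; exact: caffine.
- by move=> y; exact: cvg_id.
- move=> r /=; rewrite !in_itv /= => /andP[? ?].
  by rewrite le_max !ge_max; apply/andP; split; lra.
- by minmax.
- by minmax.
- by rewrite -[RHS]f0; congr f; minmax.
- by rewrite -[RHS]f1; congr f; minmax.
- move=> r _; rewrite /concat; case: leP => r1.
    by rewrite -[LHS]f0; congr f; minmax.
  by congr f; minmax.
Qed.

Local Lemma pi1_mulr1 x : right_id (pi1_one x) (@pi1_mul x).
Proof.
elim/quotW => f; rewrite /pi1_one pi1_mulE; apply: pi1P.
case: f => f lf /=; have [_ f0 f1] := lf.
apply: (@reparam x f (fun t => Num.min (2 * t + 0) (0 * t + 1)) id) => //.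
- by apply: cmin; exact: caffine.
- by move=> y; exact: cvg_id.
- move=> r /=; rewrite !in_itv /= => /andP[? ?].
  by rewrite le_min !ge_min; apply/andP; split; lra.
- by minmax.
- by minmax.
- by rewrite -[RHS]f0; congr f; minmax.
- by rewrite -[RHS]f1; congr f; minmax.
- move=> r _; rewrite /concat; case: leP => r1.
    by congr f; minmax.
  by rewrite -[LHS]f1; congr f; minmax.
Qed.

Local Lemma pi1_mulV x : left_inverse (pi1_one x) (@pi1_inv x) (@pi1_mul x).
Proof.
elim/quotW => f; rewrite /pi1_one pi1_invE pi1_mulE; apply: pi1P.
case: f => f lf /=; have [_ f0 f1] := lf.
apply: (@reparam x f (fun t => Num.max (-2 * t + 1) (2 * t + -1))
  (fun t => 0 * t + 1)) => //.
- by apply: cmax; exact: caffine.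
- exact: caffine.
- move=> r /=; rewrite !in_itv /= => /andP[? ?].
  by rewrite le_max !ge_max; apply/andP; split; lra.
- by move=> r /=; rewrite !in_itv /= => /andP[? ?]; lra.
- by minmax.
- by minmax.
- by rewrite -[RHS]f1; congr f; minmax.
- by rewrite -[RHS]f1; congr f; minmax.
- move=> r _; rewrite /concat /reverse; case: leP => r1;
    by congr f; minmax.
- by move=> r _; rewrite mul0r add0r f1.
Qed.

Local Lemma pi1_mulVr x : right_inverse (pi1_one x) (@pi1_inv x) (@pi1_mul x).
Proof.
elim/quotW => f; rewrite /pi1_one pi1_invE pi1_mulE; apply: pi1P.
case: f => f lf /=; have [_ f0 f1] := lf.
apply: (@reparam x f (fun t => Num.min (2 * t + 0) (-2 * t + 2))
  (fun t => 0 * t + 0)) => //.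
- by apply: cmin; exact: caffine.
- exact: caffine.
- move=> r /=; rewrite !in_itv /= => /andP[? ?].
  by rewrite le_min !ge_min; apply/andP; split; lra.
- by move=> r /=; rewrite !in_itv /= => /andP[? ?]; lra.
- by minmax.
- by minmax.
- by rewrite -[RHS]f0; congr f; minmax.
- by rewrite -[RHS]f0; congr f; minmax.
- move=> r _; rewrite /concat /reverse; case: leP => r1;
    by congr f; minmax.
- by move=> r _; rewrite mul0r add0r f0.
Qed.

HB.instance Definition _ x := isGroup.Build (pi1 x)
  (@pi1_mulA x) (@pi1_mul1 x) (@pi1_mulr1 x) (@pi1_mulV x) (@pi1_mulVr x).

End FundamentalGroup.
Arguments pi1 R {T} x.

(* Complex projective space.  [Cplx R] is R[i]; points of CP^n are classes of
   nonzero row vectors, with the quotient topology. *)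
Definition Cplx (R : realType) : numClosedFieldType := R[i]%C.

Section ProjectiveSpace.
Variables (R : realType) (n : nat).
Local Notation C := (Cplx R).

Definition nonzero : set 'rV[C]_n.+1 := [set v | v != 0].

Definition same_line : rel nonzero :=
  fun u v => `[< exists2 c : C, c != 0 & set_val v = c *: set_val u >].

Local Lemma same_line_refl : reflexive same_line.
Proof. by move=> u; apply/asboolP; exists 1; rewrite ?oner_eq0 ?scale1r. Qed.

Local Lemma same_line_sym : symmetric same_line.
Proof.
move=> u v; apply/asboolP/asboolP => -[c c0 E]; exists c^-1;
  by rewrite ?invr_eq0// E scalerA mulVf// scale1r.
Qed.

Local Lemma same_line_trans : transitive same_line.
Proof.
move=> v u w /asboolP[c c0 E] /asboolP[d d0 F]; apply/asboolP.
by exists (d * c); rewrite ?mulf_neq0// F E scalerA.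
Qed.

Canonical same_line_equiv :=
  EquivRel same_line same_line_refl same_line_sym same_line_trans.

Definition CP : Type := quotient_topology {eq_quot same_line_equiv}.
HB.instance Definition _ := Topological.on CP.
HB.instance Definition _ := Quotient.on CP.

Local Lemma const1_nonzero : nonzero (const_mx 1).
Proof.
by rewrite /nonzero /=; apply/eqP => /rowP /(_ 0) /eqP; rewrite !mxE oner_eq0.
Qed.

(* The point [v]; the value at v = 0 is irrelevant. *)
Definition pt (v : 'rV[C]_n.+1) : CP :=
  \pi_CP (insubd (exist (fun u => u \in nonzero) _ (mem_set const1_nonzero)) v).

(* A choice of homogeneous coordinates. *)
Definition hcoord (p : CP) : 'rV[C]_n.+1 := set_val (generic_quotient.repr p).

End ProjectiveSpace.
Arguments nonzero R n : clear implicits.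

Section AlgebraicGeometry.
Variable R : realType.
Local Notation C := (Cplx R).
Local Notation poly n := (mpoly.mpoly n C).
Local Notation "F .@[ v ]" := (mpoly.meval (fun i => v 0 i) F) (at level 2).

Definition homogeneous n (F : poly n) : Prop :=
  exists d, forall m, mpoly.mcoeff m F != 0 -> mpoly.mdeg m = d.

Definition zero_locus n (I : set (poly n.+1)) : set (CP R n) :=
  [set p | forall F, I F -> F.@[hcoord p] = 0].

Definition algebraic n (X : set (CP R n)) : Prop :=
  exists2 I : set (poly n.+1), I `<=` @homogeneous n.+1 & X = zero_locus I.

Definition irreducible n (X : set (CP R n)) : Prop :=
  X !=set0 /\ forall A B, algebraic A -> algebraic B ->
    X `<=` A `|` B -> X `<=` A \/ X `<=` B.

Definition ideal n (X : set (CP R n)) : set (poly n.+1) :=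
  [set F | homogeneous F /\ forall p, X p -> F.@[hcoord p] = 0].

(* The tangent space, at [hcoord p], of the affine cone over X. *)
Definition tangent n (X : set (CP R n)) (p : CP R n) : set 'rV[C]_n.+1 :=
  [set w | forall F, ideal X F ->
     \sum_i (mpoly.mderiv i F).@[hcoord p] * w 0 i = 0].

(* A nonsingular projective surface: the affine cone has everywhere a tangent
   space of dimension 3. *)
Definition projective_surface n (X : set (CP R n)) : Prop :=
  [/\ algebraic X, irreducible X & forall p, X p -> exists2 B : 'M[C]_(3, n.+1),
      row_free B & tangent X p = [set w | (w <= B)%MS]].

(* P holds on a nonempty Zariski open subset of the space of matrices. *)
Definition generically m k (P : 'M[C]_(m, k) -> Prop) : Prop :=
  exists2 F : poly (m * k), (exists L, F.@[mxvec L] != 0) &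
    forall L, F.@[mxvec L] != 0 -> P L.

Definition has_degree n (X : set (CP R n)) (d : nat) : Prop :=
  generically (fun L : 'M[C]_(n.+1, 2) =>
    (X `&` [set p | hcoord p *m L = 0] #= `I_d)%card).

(* Linear projection CP^n - -> CP^2, well defined off {p | hcoord p *m M = 0}. *)
Definition lproj n (M : 'M[C]_(n.+1, 3)) (p : CP R n) : CP R 2 :=
  pt (hcoord p *m M).

Definition ramified n (X : set (CP R n)) (M : 'M[C]_(n.+1, 3)) : set (CP R n) :=
  [set p | X p /\ exists w, [/\ tangent X p w, w != 0 & w *m M = 0]].

Definition branch_curve n (X : set (CP R n)) (M : 'M[C]_(n.+1, 3)) :
    set (CP R 2) :=
  lproj M @` ramified X M.

Definition holomorphic_near (E F : normedModType C) (h : E -> F) (e : E) : Prop :=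
  \forall z \near e, differentiable h z.

(* u |-> pt (phi u) is a holomorphic parametrization of an open neighbourhood
   of p in X by an open neighbourhood U of 0 in C^d. *)
Definition local_param n d (X : set (CP R n)) (p : CP R n)
    (U : set 'rV[C]_d) (phi : 'rV[C]_d -> 'rV[C]_n.+1) : Prop :=
  [/\ [/\ open U, U 0 & pt (phi 0) = p],
      forall u, U u -> [/\ differentiable phi u, phi u != 0, X (pt (phi u))
        & forall w c, 'd phi u w = c *: phi u -> w = 0],
      {in U &, injective (fun u => pt (phi u))}
    & forall W, W `<=` U -> open W ->
        exists2 O, open O & [set pt (phi u) | u in W] = X `&` O].

Definition vec2 (a b : C) : 'rV[C]_2 := \row_j (if j == 0 then a else b).
Definition fold_map (u : 'rV[C]_2) := vec2 (u 0 0 ^+ 2) (u 0 1).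
Definition cusp_map (u : 'rV[C]_2) :=
  vec2 (u 0 0 ^+ 3 + u 0 0 * u 0 1) (u 0 1).

Definition locally_equivalent n (X : set (CP R n)) (M : 'M[C]_(n.+1, 3))
    (p : CP R n) (g : 'rV[C]_2 -> 'rV[C]_2) : Prop :=
  exists U phi W psi,
    [/\ local_param X p U phi, local_param setT (lproj M p) W psi
      & forall u, U u -> W (g u) /\ lproj M (pt (phi u)) = pt (psi (g u))].

Definition tangent_image n (X : set (CP R n)) (M : 'M[C]_(n.+1, 3))
    (p : CP R n) : set 'rV[C]_3 :=
  [set w *m M | w in tangent X p].

(* A finite linear projection which is stable: its only singularities are folds
   and cusps, and two of its branches over a same point are transverse folds. *)
Definition generic_projection n (X : set (CP R n)) (M : 'M[C]_(n.+1, 3)) : Prop :=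
  [/\ forall p, X p -> hcoord p *m M != 0,
      forall p, ramified X M p -> locally_equivalent X M p fold_map \/
                                  locally_equivalent X M p cusp_map,
      forall p p', ramified X M p -> ramified X M p' -> p <> p' ->
        lproj M p = lproj M p' ->
        [/\ locally_equivalent X M p fold_map, locally_equivalent X M p' fold_map
          & tangent_image X M p <> tangent_image X M p']
    & forall y s, uniq s ->
        (forall p, p \in s -> ramified X M p /\ lproj M p = y) -> (size s <= 2)%N].

Definition galois_cover n (X : set (CP R n)) (M : 'M[C]_(n.+1, 3)) (d : nat) :
    set (prod_topology (fun _ : 'I_d => CP R n)) :=
  closure ([set x : 'I_d -> CP R n |
    [/\ forall i, X (x i), forall i j, lproj M (x i) = lproj M (x j)
      & injective x]] : set (prod_topology (fun _ : 'I_d => CP R n))).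

Definition holomorphic_map n m (X : set (CP R n)) (g : CP R n -> CP R m) : Prop :=
  forall v : 'rV[C]_n.+1, v != 0 -> X (pt v) ->
    exists2 h : 'rV[C]_n.+1 -> 'rV[C]_m.+1, holomorphic_near h v &
      \forall z \near v, X (pt z) -> h z != 0 /\ g (pt z) = pt (h z).

Definition biholomorphic n m (X : set (CP R n)) (Y : set (CP R m))
    (f : CP R n -> CP R m) (g : CP R m -> CP R n) : Prop :=
  [/\ holomorphic_map X f, holomorphic_map Y g,
      forall p, X p -> Y (f p) /\ g (f p) = p
    & forall q, Y q -> X (g q) /\ f (g q) = q].

(* Families over the unit disc are subsets V of Delta x CP^m.  The point
   (t, v) with v != 0 stands for (t, [v]). *)
Local Notation param_cone m := (C^o * 'rV[C]_m.+1)%type.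

Definition cpt m (e : param_cone m) : C * CP R m := (e.1, pt e.2).

Definition analytic m (V : set (C * CP R m)) : Prop :=
  (forall z, V z -> `|z.1| < 1) /\
  forall e : param_cone m, `|e.1| < 1 -> e.2 != 0 ->
    exists k (h : param_cone m -> 'rV[C]_k), holomorphic_near h e /\
      \forall z \near e, V (cpt z) <-> h z = 0.

(* Flatness of V (with its reduced structure) over the disc: the local
   parameters of the disc are nonzerodivisors in the local rings of V. *)
Definition flat m (V : set (C * CP R m)) : Prop :=
  forall e : param_cone m, e.2 != 0 -> V (cpt e) ->
  forall h : param_cone m -> C^o, holomorphic_near h e ->
    (\forall z \near e, V (cpt z) -> (z.1 - e.1) * h z = 0) ->
    \forall z \near e, V (cpt z) -> h z = 0.

(* The fibre over 0 of V is reduced. *)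
Definition reduced_central_fibre m (V : set (C * CP R m)) : Prop :=
  forall e : param_cone m, e.1 = 0 -> e.2 != 0 -> V (cpt e) ->
  forall h : param_cone m -> C^o, holomorphic_near h e ->
    (\forall z \near e, V (cpt z) -> z.1 = 0 -> h z = 0) ->
    exists2 k : param_cone m -> C^o, holomorphic_near k e &
      \forall z \near e, V (cpt z) -> h z = z.1 * k z.

(* Near every point outside the fibre over 0, V is isomorphic over the disc to
   a product of an open subset of the disc with an open subset of C^2. *)
Definition smooth_off_center m (V : set (C * CP R m)) : Prop :=
  forall z0, V z0 -> z0.1 != 0 ->
  exists (U : set (C^o * 'rV[C]_2)) (phi : C^o * 'rV[C]_2 -> 'rV[C]_m.+1),
  let Phi := fun u : C^o * 'rV[C]_2 => (u.1, pt (phi u)) : C * CP R m in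
  [/\ [/\ open U, U (z0.1, 0) & Phi (z0.1, 0) = z0],
      forall u, U u -> [/\ differentiable phi u, phi u != 0, V (Phi u)
        & forall w c, 'd phi u (0, w) = c *: phi u -> w = 0],
      {in U &, injective Phi}
    & forall W, W `<=` U -> open W ->
        exists2 O, open O & Phi @` W = V `&` O].

Definition holomorphic_on_family m k (V : set (C * CP R m))
    (g : C * CP R m -> CP R k) : Prop :=
  forall e : param_cone m, e.2 != 0 -> V (cpt e) ->
    exists2 h : param_cone m -> 'rV[C]_k.+1, holomorphic_near h e &
      \forall z \near e, V (cpt z) -> h z != 0 /\ g (cpt z) = pt (h z).

Definition fibre m (V : set (C * CP R m)) (t : C) : set (CP R m) :=
  [set p | V (t, p)].

End AlgebraicGeometry.
Arguments galois_cover {R n} X M d%_nat_scope _.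

(* A shadow: triangles, given by their vertices, and numbered (nonredundant)
   edges, given by their end points. *)
Record shadow := Shadow {
  ntri : nat; nvert : nat; nedge : nat;
  tri : 'I_ntri -> {set 'I_nvert};
  edge : 'I_nedge -> {set 'I_nvert} }.

Definition shares (Sh : shadow) (e : 'I_(nedge Sh)) (i j : 'I_(ntri Sh)) : bool :=
  [&& i != j, edge e \subset tri i & edge e \subset tri j].

Section Degeneration.
Variable R : realType.
Local Notation C := (Cplx R).

(* The projective subspace of CP^2 spanned by the points a i, i in A. *)
Definition span_pts (I : finType) (A : {set I}) (a : I -> CP R 2) : set (CP R 2) :=
  [set y | (hcoord y <= \sum_(i in A) <<hcoord (a i)>>)%MS].

(* The central fibre X0 is a union of planes with shadow Sh, and p0 is a
   generic projection of X0.  Plane i is identified with CP^2 by L i, with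
   inverse K i; this gives a sense to its lines.  Vertex a of the shadow is the
   point vx a, and edge e is the line through its vertices in either of the two
   planes.  No condition relates the redundant edges, so that two planes may
   meet in two points. *)
Record union_of_planes (Sh : shadow) m (X0 : set (CP R m)) (p0 : CP R m -> CP R 2)
    (L : 'I_(ntri Sh) -> CP R 2 -> CP R m) (K : 'I_(ntri Sh) -> CP R m -> CP R 2)
    (vx : 'I_(nvert Sh) -> CP R m) : Prop := {
  planes_biholomorphic : forall i, biholomorphic setT (range (L i)) (L i) (K i);
  planes_cover : X0 = \bigcup_i range (L i);
  vertices_injective : injective vx;
  vertices_on_planes : forall i a, a \in tri i -> range (L i) (vx a);
  vertices_noncollinear : forall i,
    span_pts (tri i) (fun a => K i (vx a)) = setT;
  planes_meet_in_line : forall e i j, shares e i j ->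
    range (L i) `&` range (L j) = L i @` span_pts (edge e) (fun a => K i (vx a));
  planes_meet_in_points : forall i j, i != j -> (forall e, ~~ shares e i j) ->
    range (L i) `&` range (L j) = vx @` [set a | a \in tri i :&: tri j];
  (* near each point, X0 looks like a union of linear planes *)
  planes_locally_linear : forall p, X0 p ->
    exists (U : set 'rV[C]_m) psi, local_param setT p U psi /\
      forall i, range (L i) p -> exists2 D : 'M[C]_(2, m), row_free D &
        forall u, U u -> range (L i) (pt (psi u)) <-> (u <= D)%MS;
  projection_linear : forall i, exists2 B : 'M[C]_3, B \in unitmx &
    forall v, v != 0 -> p0 (L i (pt v)) = pt (v *m B);
  projection_vertex : forall e a,
    span_pts (edge e) (p0 \o vx) (p0 (vx a)) -> a \in edge e;
  projection_triple : forall y e1 e2 e3, uniq [:: e1; e2; e3] ->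
    (forall e, e \in [:: e1; e2; e3] -> span_pts (edge e) (p0 \o vx) y) ->
    exists a, y = p0 (vx a) }.

(* A degeneration of the projection M : X -> CP^2, inside Delta x CP^m; the
   map F of the family is z |-> (z.1, rho z). *)
Definition projective_degeneration (Sh : shadow) n (X : set (CP R n))
    (M : 'M[C]_(n.+1, 3)) : Prop :=
  exists m (V : set (C * CP R m)) (rho : C * CP R m -> CP R 2),
  [/\ [/\ analytic V, flat V, reduced_central_fibre V & smooth_off_center V],
      holomorphic_on_family V rho,
      exists L K vx,
        @union_of_planes Sh m (fibre V 0) (fun p => rho (0, p)) L K vx
    & exists2 t0 : C, t0 != 0 &
      exists f g, biholomorphic X (fibre V t0) f g /\
        forall p, X p -> rho (t0, f p) = lproj M p ].

End Degeneration.

Section Presentations.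
Local Open Scope group_scope.

(* Words in the generators of T and their inverses; (x, true) is x^-1. *)
Definition word (T : Type) := seq (T * bool).
Definition winv T (w : word T) : word T := rev [seq (x.1, ~~ x.2) | x <- w].

Definition weval T (G : groupType) (gam : T -> G) (w : word T) : G :=
  \big[*%g/1]_(x <- w) (if x.2 then (gam x.1)^-1 else gam x.1).

(* Equality of words in the group < T | rels >. *)
Inductive weq T (rels : set (word T)) : word T -> word T -> Prop :=
| weq_refl u : weq rels u u
| weq_sym u v : weq rels u v -> weq rels v u
| weq_trans u v w : weq rels u v -> weq rels v w -> weq rels u w
| weq_cat u u' v v' : weq rels u u' -> weq rels v v' ->
    weq rels (u ++ v) (u' ++ v')
| weq_cancel x b : weq rels [:: (x, b); (x, ~~ b)] [::]
| weq_rel r : rels r -> weq rels r [::].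

(* gam induces an isomorphism from < T | rels > onto G. *)
Definition presented_by T (G : groupType) (gam : T -> G) (rels : set (word T)) :
    Prop :=
  (forall x, exists w, weval gam w = x) /\
  (forall u v, weval gam u = weval gam v <-> weq rels u v).

Inductive normal_closure (G : groupType) (B : set G) : set G :=
| ncl_in x : B x -> normal_closure B x
| ncl_1 : normal_closure B 1
| ncl_M x y : normal_closure B x -> normal_closure B y -> normal_closure B (x * y)
| ncl_V x : normal_closure B x -> normal_closure B x^-1
| ncl_J x y : normal_closure B x -> normal_closure B (x ^ y).

Variables (G : groupType) (B : set G).

Definition ncl_rel : rel G := fun x y => `[< normal_closure B (x^-1 * y) >].

Local Lemma ncl_refl : reflexive ncl_rel.
Proof. by move=> x; apply/asboolP; rewrite mulVg; exact: ncl_1. Qed.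

Local Lemma ncl_sym : symmetric ncl_rel.
Proof.
by move=> x y; apply/asboolP/asboolP => /ncl_V; rewrite invgM invgK.
Qed.

Local Lemma ncl_trans : transitive ncl_rel.
Proof.
move=> y x z /asboolP xy /asboolP yz; apply/asboolP.
by have := ncl_M xy yz; rewrite -mulgA mulKVg.
Qed.

Canonical ncl_equiv := EquivRel ncl_rel ncl_refl ncl_sym ncl_trans.

(* The quotient of G by the normal closure of B. *)
Definition quot_ncl : Type := {eq_quot ncl_equiv}.
HB.instance Definition _ := Choice.on quot_ncl.
HB.instance Definition _ := EqQuotient.on quot_ncl.

Definition to_quot (x : G) : quot_ncl := \pi_quot_ncl x.
Let q1 : quot_ncl := to_quot 1.
Let qM (a b : quot_ncl) : quot_ncl :=
  to_quot (generic_quotient.repr a * generic_quotient.repr b).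
Let qV (a : quot_ncl) : quot_ncl := to_quot (generic_quotient.repr a)^-1.

Local Lemma to_quotP x y : normal_closure B (x^-1 * y) -> to_quot x = to_quot y.
Proof. by move=> xy; apply/eqmodP/asboolP. Qed.

Local Lemma repr_quot x :
  normal_closure B ((generic_quotient.repr (to_quot x))^-1 * x).
Proof. by have /eqmodP /asboolP := reprK (to_quot x). Qed.

Local Lemma qME x y : qM (to_quot x) (to_quot y) = to_quot (x * y).
Proof.
apply: to_quotP; set u := generic_quotient.repr _; set v := generic_quotient.repr _.
have hx : normal_closure B (u^-1 * x) := repr_quot x.
have hy : normal_closure B (v^-1 * y) := repr_quot y.
have -> : (u * v)^-1 * (x * y) = (u^-1 * x) ^ v * (v^-1 * y).
  by rewrite conjgE invgM !mulgA mulgK.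
exact/ncl_M/hy/ncl_J.
Qed.

Local Lemma qVE x : qV (to_quot x) = to_quot x^-1.
Proof.
apply: to_quotP; set u := generic_quotient.repr _.
have hx : normal_closure B (u^-1 * x) := repr_quot x.
have -> : u^-1^-1 * x^-1 = ((u^-1 * x)^-1) ^ u^-1.
  by rewrite conjgE !invgK invgM invgK !mulgA mulgK.
exact/ncl_J/ncl_V.
Qed.

Local Lemma qA : associative qM.
Proof.
elim/quotW => x; elim/quotW => y; elim/quotW => z; rewrite -!/(to_quot _).
by rewrite (qME y z) (qME x y) !qME mulgA.
Qed.
Local Lemma q1M : left_id q1 qM.
Proof. by elim/quotW => x; rewrite -!/(to_quot _) qME mul1g. Qed.
Local Lemma qM1 : right_id q1 qM.
Proof. by elim/quotW => x; rewrite -!/(to_quot _) qME mulg1. Qed.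
Local Lemma qVM : left_inverse q1 qV qM.
Proof. by elim/quotW => x; rewrite -!/(to_quot _) qVE qME mulVg. Qed.
Local Lemma qMV : right_inverse q1 qV qM.
Proof. by elim/quotW => x; rewrite -!/(to_quot _) qVE qME mulgV. Qed.

HB.instance Definition _ := isGroup.Build quot_ncl qA q1M qM1 qVM qMV.

Lemma to_quotM : {morph to_quot : x y / x * y}.
Proof. by move=> x y; rewrite -[RHS]/(qM _ _) qME. Qed.

End Presentations.

(* The relators. The generator gamma_i is (i, false) and gamma_i' is (i, true);
   edges are numbered from 1 in the relations and from 0 in 'I_11. *)
Definition gen : Type := ('I_11 * bool)%type.

Declare Scope word_scope.
Delimit Scope word_scope with W.
Notation "u * v" := (cat u v) : word_scope.
Notation "u ^-1" := (winv u) : word_scope.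

Section Relators.
Local Open Scope word_scope.
Local Notation W := (word gen).

Definition gam (i : nat) : W := [:: ((inord i.-1, false), false)].
Definition gam' (i : nat) : W := [:: ((inord i.-1, true), false)].

Definition comm (x y : W) : W := x * y * x^-1 * y^-1.
Definition triple (x y : W) : W := x * y * x * y^-1 * x^-1 * y^-1.
Definition eqn (x y : W) : W := x * y^-1.

Definition R4 (i j k l : nat) : seq W :=
  let: (a, a', b, b') := (gam i, gam' i, gam j, gam' j) in
  let: (c, c', d, d') := (gam k, gam' k, gam l, gam' l) in
  [:: triple a' b; triple a' b'; triple a' (b^-1 * b' * b);
      triple c d; triple c' d; triple (c^-1 * c' * c) d;
      comm (b' * b * a' * b^-1 * b'^-1) d;
      comm (b' * b * a' * b^-1 * b'^-1)
           (c^-1 * c'^-1 * d^-1 * d' * d * c' * c);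
      triple a b; triple a b'; triple a (b^-1 * b' * b);
      triple c (d^-1 * d' * d); triple c' (d^-1 * d' * d);
      triple (c^-1 * c' * c) (d^-1 * d' * d);
      comm (b' * b * a * b^-1 * b'^-1) (d^-1 * d' * d);
      comm (b' * b * a * b^-1 * b'^-1)
           (c^-1 * c'^-1 * d^-1 * d'^-1 * d * d' * d * c' * c);
      eqn (b' * b * a' * b * a'^-1 * b^-1 * b'^-1) (d * c' * d^-1);
      eqn (b' * b * a' * b' * a'^-1 * b^-1 * b'^-1)
          (d * c' * c * c'^-1 * d^-1);
      eqn (b' * b * a * b * a^-1 * b^-1 * b'^-1)
          (d^-1 * d' * d * c' * d^-1 * d'^-1 * d);
      eqn (b' * b * a * b' * a^-1 * b^-1 * b'^-1)
          (d^-1 * d' * d * c' * c * c'^-1 * d^-1 * d'^-1 * d)].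

Definition R3 (i j k : nat) : seq W :=
  let: (a, a', b, b') := (gam i, gam' i, gam j, gam' j) in
  let: (c, c') := (gam k, gam' k) in
  [:: triple a' b; triple a' b'; triple a' (b^-1 * b' * b);
      eqn a (b' * b * a' * b^-1 * b'^-1);
      triple c (b' * b * a' * b * a'^-1 * b^-1 * b'^-1);
      triple c (b' * b * a' * b' * a'^-1 * b^-1 * b'^-1);
      triple c (b' * b * a' * b^-1 * b' * b * a'^-1 * b^-1 * b'^-1);
      eqn c' (c * b' * b * a' * b' * b * a'^-1 * b^-1 * b'^-1
              * c * b' * b * a' * b^-1 * b'^-1 * a'^-1 * b^-1 * b'^-1 * c^-1);
      comm a c; comm a c'; comm a' c; comm a' c'].

Definition R5 (i j : nat) : seq W :=
  [:: comm (gam i) (gam j); comm (gam i) (gam' j);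
      comm (gam' i) (gam j); comm (gam' i) (gam' j)].

Definition disjoint_edges : seq (nat * nat) :=
  [seq (1, j) | j <- [:: 5; 6; 7; 9; 10]] ++
  [seq (2, j) | j <- [:: 6; 7; 8; 10; 11]] ++
  [seq (3, j) | j <- [:: 5; 7; 9; 11]] ++
  [:: (4, 9)] ++
  [seq (i, j) | i <- [:: 4; 5], j <- [:: 8; 10; 11]] ++
  [seq (6, j) | j <- [:: 9; 11]] ++
  [seq (8, j) | j <- [:: 7; 9]].

Definition RP : W := flatten [seq gam' i * gam i | i <- rev (iota 1 11)].

Definition X3_relators : set (word gen) :=
  [set r | r \in
     R4 1 2 3 4 ++ R4 3 6 8 10 ++ R4 4 5 6 7 ++ R4 7 9 10 11 ++
     R3 2 5 9 ++ R3 1 8 11 ++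
     flatten [seq R5 e.1 e.2 | e <- disjoint_edges] ++ [:: RP]].

End Relators.

(* Vertices are numbered from 1 in these lists and from 0 in 'I_6. *)
Definition X3_triangles : seq (seq nat) :=
  [:: [:: 1; 6; 5]; [:: 1; 5; 3]; [:: 1; 3; 2]; [:: 1; 2; 6];
      [:: 4; 5; 3]; [:: 4; 5; 6]; [:: 4; 6; 2]; [:: 4; 2; 3]]%N.
Definition X3_edges : seq (seq nat) :=
  [:: [:: 1; 6]; [:: 1; 5]; [:: 1; 2]; [:: 1; 3]; [:: 3; 5]; [:: 2; 3];
      [:: 3; 4]; [:: 2; 6]; [:: 4; 5]; [:: 2; 4]; [:: 4; 6]]%N.

Definition X3 : shadow := @Shadow 8 6 11
  (fun i => [set a : 'I_6 | a.+1 \in nth [::] X3_triangles i]%SET)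
  (fun e => [set a : 'I_6 | a.+1 \in nth [::] X3_edges e]%SET).

(* The exact sequence 1 -> P -> G / <<gamma^2>> -> S_n -> 1. *)
Definition galois_exact_sequence (Sh : shadow) (P G : groupType)
    (gamma : 'I_(nedge Sh) * bool -> G) : Prop :=
  let Q := quot_ncl (range (fun x => gamma x * gamma x)%g) in
  exists (iota : P -> Q) (theta : Q -> 'S_(ntri Sh)),
    [/\ {morph iota : x y / (x * y)%g} /\ {morph theta : x y / (x * y)%g},
        injective iota,
        range iota = [set x | theta x = 1%g],
        range theta = setT
      & forall e b i j, shares e i j ->
          theta (to_quot _ (gamma (e, b))) = tperm i j].
Arguments galois_exact_sequence Sh P {G} gamma.

(* Main.v *)
(* All generators become involutions in the quotient Q of G by the squares, and
   the theorem says that theta : Q -> S_8 is injective.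

   Q is first shown not to distinguish gamma_i from gamma_i'.  Put
   th_i = gamma_i' gamma_i.  Relation (RP) says that th_5 th_4 th_3 th_2 th_1
   commutes with gamma_2, because all the other factors do.  With the relations
   at V_1 and V_5, this writes gamma_2 gamma_2' as a product of conjugates of
   th_1 which commute with gamma_5' gamma_2 gamma_5'; since gamma_2, gamma_2'
   both satisfy the braid relation with gamma_5', this gives
   gamma_2 = gamma_2'.  The relations at the six vertices then propagate the
   equality to all the edges.

   The path 0, 1, 4, 5, 6, 7, 2, 3 through the eight triangles crosses the edges
   2, 5, 9, 11, 10, 6, 3.  Their generators satisfy the Coxeter relations of
   S_8 and generate Q, so that theta is injective by the usual normal form of
   the elements of a Coxeter group of type A. *)
Require Import Defs.
From HB Require Import structures.
From mathcomp Require Import all_boot all_order all_fingroup all_algebra.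
From mathcomp Require Import complex.
From mathcomp Require Import all_classical all_reals all_analysis.

Import Order.TTheory GRing.Theory Num.Theory numFieldNormedType.Exports.

Set Implicit Arguments.
Unset Strict Implicit.
Unset Printing Implicit Defensive.

Local Open Scope group_scope.

(** * Involutions, braid relations and conjugation *)

Definition involution (G : groupType) (x : G) := x^-1 = x.
Definition braid (G : groupType) (x y : G) := x * y * x = y * x * y.

Section Conjugation.
Variable G : groupType.
Implicit Types x y z g : G.

Lemma involutionP x : x * x = 1 -> involution x.
Proof. by move=> xx; rewrite /involution -[LHS]mulg1 -xx mulKg. Qed.

Lemma mulg_sq x : involution x -> x * x = 1.
Proof. by move=> xV; rewrite -{1}xV mulVg. Qed.

Lemma mulg_sqK x y : involution x -> y * x * x = y.
Proof. by move=> xV; rewrite -mulgA mulg_sq ?mulg1. Qed.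

Lemma involutionJ x g : involution x -> involution (x ^ g).
Proof. by rewrite /involution -conjVg => ->. Qed.

Lemma conj_sq x y : involution x -> y ^ x = x * y * x.
Proof. by rewrite conjgE mulgA => ->. Qed.

Lemma conjg_commute x y : commute x y -> x ^ y = x.
Proof. by move=> xy; rewrite conjgE xy mulKg. Qed.

Lemma commuteJ x y g : commute (x ^ g) (y ^ g) <-> commute x y.
Proof. by rewrite /commute -!conjMg; split=> [|-> //]; exact: conjg_inj. Qed.

Lemma braidJ x y g : braid (x ^ g) (y ^ g) <-> braid x y.
Proof. by rewrite /braid -!conjMg; split=> [|-> //]; exact: conjg_inj. Qed.

Lemma braidr x y z : braid x y -> z * x * y * x = z * y * x * y.
Proof. by rewrite /braid -!mulgA => ->. Qed.

Lemma commuter x y z : commute x y -> z * x * y = z * y * x.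
Proof. by rewrite /commute -!mulgA => ->. Qed.

Lemma braid_sym x y : braid x y -> braid y x.
Proof. by []. Qed.

Lemma braid_conj x y : involution x -> involution y -> braid x y -> x ^ y = y ^ x.
Proof. by move=> xV yV xy; rewrite !conj_sq. Qed.

Lemma braid_conj2 x y : involution x -> involution y -> braid x y ->
  x ^ (y * x) = y.
Proof.
by move=> xV yV xy; rewrite conjgM (braid_conj xV yV xy) -conjgM mulg_sq ?conjg1.
Qed.

Lemma braid_triple x y : x * y * x * y^-1 * x^-1 * y^-1 = 1 <-> braid x y.
Proof.
rewrite /braid; split=> [/(canRL (mulgVK _))|->].
  by rewrite mul1g => /(canRL (mulgVK _)) /(canRL (mulgVK _)).
by rewrite !mulgK mulgV.
Qed.

Lemma commute_comm x y : x * y * x^-1 * y^-1 = 1 <-> commute x y.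
Proof.
rewrite /commute; split=> [/(canRL (mulgVK _))|->].
  by rewrite mul1g => /(canRL (mulgVK _)).
by rewrite mulgK mulgV.
Qed.

Lemma eq_div x y : x * y^-1 = 1 <-> x = y.
Proof. by split=> [/(canRL (mulgVK _))|->]; rewrite ?mul1g ?mulgV. Qed.

End Conjugation.

Ltac cancel_sq := rewrite ?mulgA; repeat match goal with
  | H : involution ?x |- context [?y * ?x * ?x] => rewrite (mulg_sqK y H)
  | H : involution ?x |- context [?x * ?x] => rewrite (mulg_sq H)
  | |- context [1 * _] => rewrite mul1g
  | |- context [_ * 1] => rewrite mulg1
  end.

(* The hypotheses make x, y, y' reflections of an affine Weyl group of type A_2,
   where y y' and its conjugate by x are translations. *)
Lemma braid_translation_commute (G : groupType) (x y y' : G) :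
  involution x -> involution y -> involution y' ->
  braid x y -> braid x y' -> braid x (y' ^ y) -> commute (y * y') ((y * y') ^ x).
Proof.
move=> xV yV y'V xy xy' xy1.
(* [w] is a translation too. Writing [(y * y') ^ x] as a conjugate of [w] by [y] and by [y' ^ y]
   shows that [y * y'], the product of [y' ^ y] and [y], fixes [w]. *)
pose w := x * x ^ (y' * y).
have Ey : (y * y') ^ x = w ^ y.
  rewrite (conjMg y) (conjMg x) -(conjgM x) mulg_sqK // -(braid_conj xV yV xy).
  by rewrite -(braid_conj xV y'V xy').
have Ey1 : (y * y') ^ x = w ^ (y' ^ y).
  have y1V : involution (y' ^ y) by exact: involutionJ.
  have -> : y * y' = y' ^ y * y by rewrite conj_sq //; cancel_sq.
  rewrite (conjMg _ y) (conjMg x) -(conjgM x).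
  rewrite -(braid_conj xV y1V xy1) -(braid_conj xV yV xy).
  by congr (_ * x ^ _); rewrite conj_sq //; cancel_sq.
have wfix : w ^ (y * y') = w.
  have -> : y * y' = y' ^ y * y by rewrite conj_sq //; cancel_sq.
  by rewrite conjgM -Ey1 Ey -conjgM mulg_sq ?conjg1.
have cw : commute (y * y') w by rewrite /commute (conjgC w) wfix.
have -> : (y * y') ^ x = w * (y * y').
  by rewrite /w conj_sq // conjgE invgM yV y'V; cancel_sq.
exact: commuteM.
Qed.

(* d, p, x are the simple reflections of S_4, and q is the reflection
   commuting with p. *)
Lemma A3_commute (G : groupType) (x d p q : G) :
  involution x -> involution d -> involution p ->
  commute x d -> braid d q -> braid x p -> p ^ x = q ^ d ->
  [/\ braid d p, commute p q & p ^ (x * d) = q].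
Proof.
move=> xV dV pV xd dq xp E.
have qE : p ^ (x * d) = q by rewrite conjgM E -conjgM mulg_sq ?conjg1.
have dp : braid d p.
  apply/(braidJ d p (x * d)); rewrite qE conjg_commute //.
  exact: commuteM (commute_sym xd) (commute_refl d).
split=> //; rewrite -qE conjgM -(braid_conj xV pV xp) -conjgM.
rewrite -{1}(braid_conj2 dV pV dp); apply/commuteJ; exact: commute_sym.
Qed.

(** * The relations at a vertex with four edges *)

(* The relations (R4) between involutions, where b'ba'b^-1b'^-1 is the conjugate
   a' ^ (b * b') and d^-1d'd is d' ^ d. *)
Record four_point (G : groupType) (a a' b b' c c' d d' : G) : Prop := {
  four_point_involution_ab :
    [/\ involution a, involution a', involution b & involution b'];
  four_point_involution_cd :
    [/\ involution c, involution c', involution d & involution d'];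
  four_point_braid' :
    [/\ braid a' b, braid a' b', braid a' (b' ^ b), braid c d & braid c' d];
  four_point_braid :
    [/\ braid a b, braid a b', braid a (b' ^ b), braid c (d' ^ d)
      & braid c' (d' ^ d)];
  four_point_comm :
    [/\ commute (a' ^ (b * b')) d,
        commute (a' ^ (b * b')) (d' ^ (d * c' * c)),
        commute (a ^ (b * b')) (d' ^ d)
      & commute (a ^ (b * b')) (d ^ (d' * d * c' * c))];
  four_point_square :
    [/\ b ^ (a' * b * b') = c' ^ d, b' ^ (a' * b * b') = c ^ (c' * d),
        b ^ (a * b * b') = c' ^ (d' ^ d)
      & b' ^ (a * b * b') = c ^ (c' * d' ^ d)] }.

Section FourPoint.
Variables (G : groupType) (a a' b b' c c' d d' : G).
Hypothesis R : four_point a a' b b' c c' d d'.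
Local Notation d1 := (d' ^ d).

Let aV : involution a. Proof. by have [] := four_point_involution_ab R. Qed.
Let a'V : involution a'. Proof. by have [] := four_point_involution_ab R. Qed.
Let bV : involution b. Proof. by have [] := four_point_involution_ab R. Qed.
Let b'V : involution b'. Proof. by have [] := four_point_involution_ab R. Qed.
Let cV : involution c. Proof. by have [] := four_point_involution_cd R. Qed.
Let c'V : involution c'. Proof. by have [] := four_point_involution_cd R. Qed.
Let dV : involution d. Proof. by have [] := four_point_involution_cd R. Qed.
Let d'V : involution d'. Proof. by have [] := four_point_involution_cd R. Qed.

Let b1V : involution (b' ^ b). Proof. exact: involutionJ. Qed.
Let d1V : involution d1. Proof. exact: involutionJ. Qed.

(* (u, f) is (a', d) or (a, d1). *)
Lemma square_edges (u f : G) : involution u -> involution f ->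
  braid u b -> braid u b' -> braid u (b' ^ b) ->
  b ^ (u * b * b') = c' ^ f -> b' ^ (u * b * b') = c ^ (c' * f) ->
  c' ^ f = u ^ b' /\ c ^ f = u ^ b.
Proof.
move=> uV fV ub ub' ub1 E E'.
have c'f : c' ^ f = u ^ b'.
  by rewrite -E conjgM; congr (_ ^ _); exact: braid_conj2.
split=> //; move: E'; rewrite (conjgM c) (conjJg c) c'f => /esym/(canRL (conjgK _)) ->.
rewrite involutionJ // -conjgM.
have -> : u * b * b' * u ^ b' = b * (u * b' ^ b) * b.
  by rewrite !conj_sq //; cancel_sq; rewrite ub; cancel_sq.
by rewrite conjgM conjgM braid_conj2.
Qed.

Let x := a' ^ (b * b').
Let y := a ^ (b * b').

(** These equations stand in for [four_point_square] from here on. *)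
Lemma four_pointE :
  [/\ c' ^ d = a' ^ b', c ^ d = a' ^ b, c' ^ d1 = a ^ b' & c ^ d1 = a ^ b].
Proof.
case: R => _ _ [? ? ? ? ?] [? ? ? ? ?] _ [E1 E2 E3 E4].
have [] := square_edges a'V dV _ _ _ E1 E2 => //.
by have [] := square_edges aV d1V _ _ _ E3 E4.
Qed.

Let bb'b' : (b' ^ b) ^ (b * b') = b'.
Proof. by rewrite -!conjgM; cancel_sq; rewrite conjg_commute. Qed.

(** [A3_commute] applies with [x], [d] as outer reflections, [b'] in the middle and [c] opposite to
    [b']. Conjugation by [x * d] fixes [x] and carries the braid relation of [x] with [b'] to one
    with [c]. *)
Lemma four_point_A3 : [/\ braid d b', commute b' c, b' ^ (x * d) = c & braid x c].
Proof.
have [_ E _ _] := four_pointE.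
case: R => _ _ [a'b a'b' a'b1 cd c'd] _ [xd _ _ _] _.
have xV : involution x by exact: involutionJ.
have xb' : braid x b' by rewrite -bb'b'; apply/braidJ.
have E' : b' ^ x = c ^ d.
  by rewrite E -(braid_conj xV b'V xb') /x -conjgM; cancel_sq.
have [db' b'c Ec] := A3_commute xV dV b'V xd (braid_sym cd) xb' E'.
split=> //; rewrite -Ec -{1}(_ : x ^ (x * d) = x); first by apply/braidJ.
by apply: conjg_commute; apply: commuteM.
Qed.

(** The argument of [four_point_A3], with [b ^ b'] and [c'] for [b'] and [c]. *)
Lemma four_point_shifted_commute : commute (b ^ b') c'.
Proof.
have [E _ _ _] := four_pointE.
case: R => _ _ [a'b a'b' a'b1 cd c'd] _ [xd _ _ _] _.
have bbb' : b ^ (b * b') = b ^ b' by rewrite conjgM (conjg_commute (commute_refl b)).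
have xV : involution x by exact: involutionJ.
have pV : involution (b ^ b') by exact: involutionJ.
have xp : braid x (b ^ b') by rewrite -bbb'; apply/braidJ.
have Ep : (b ^ b') ^ x = c' ^ d.
  by rewrite E -(braid_conj xV pV xp) /x -conjgM (conj_sq b b'V); cancel_sq.
by have [] := A3_commute xV dV pV xd (braid_sym c'd) xp Ep.
Qed.

(** Conjugation by [b * b'] now fixes [c], so [a'] and [a] may be replaced by [x] and [y]. The case
    of [y] repeats [four_point_A3] with [d1] for [d]. *)
Lemma four_point_braid_ac : commute b c -> braid a' c /\ braid a c.
Proof.
move=> bc; have [_ b'c _ xc] := four_point_A3.
have [_ _ _ E] := four_pointE.
have cb : c ^ (b * b') = c by apply/conjg_commute/commuteM; exact: commute_sym.
split; first by apply/(braidJ _ _ (b * b')); rewrite cb.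
apply/(braidJ _ _ (b * b')); rewrite cb -/y.
case: R => _ _ _ [ab ab' ab1 cd1 c'd1] [_ _ yd1 _] _.
have yV : involution y by exact: involutionJ.
have yb' : braid y b' by rewrite -bb'b'; apply/braidJ.
have E' : b' ^ y = c ^ d1.
  by rewrite E -(braid_conj yV b'V yb') /y -conjgM; cancel_sq.
have [_ _ Ec] := A3_commute yV d1V b'V yd1 (braid_sym cd1) yb' E'.
rewrite -Ec -{1}(_ : y ^ (y * d1) = y); first by apply/braidJ.
by apply: conjg_commute; apply: commuteM.
Qed.

(* u ^ c and v ^ b lie over the same two disjoint transpositions of S_4 for all
   u and v; (R4) only contains the cases where u <> v, in disguise. *)
Lemma four_point_commute : commute b c -> commute b c' -> commute b' c' ->
  forall u v, u \in [:: a; a'] -> v \in [:: a; a'] -> commute (u ^ c) (v ^ b).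
Proof.
move=> bc bc' b'c'; have [_ b'c _ _] := four_point_A3.
have [a'c ac] := four_point_braid_ac bc.
have [E1 E2 E3 E4] := four_pointE.
case: R => _ _ [a'b _ _ cd c'd] [ab _ _ cd1 c'd1] [_ x8 _ y16] _.
have same u : involution u -> braid u b -> braid u c -> commute (u ^ c) (u ^ b).
  move=> uV ub uc; rewrite (braid_conj uV cV uc) (braid_conj uV bV ub).
  by apply/commuteJ; exact: commute_sym.
have d1c' : d1 ^ c' = a ^ b' by rewrite (braid_conj d1V c'V).
have dc' : d ^ c' = a' ^ b' by rewrite (braid_conj dV c'V).
have shift u v : commute (u ^ (b * b')) (v ^ (b' * c)) -> commute (u ^ c) (v ^ b).
  have -> : v ^ (b' * c) = ((v ^ b) ^ c) ^ (b * b').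
    by rewrite -!conjgM; congr (_ ^ _); cancel_sq; rewrite bc; cancel_sq; rewrite b'c.
  move/commuteJ => uv; apply/(commuteJ _ _ c); rewrite -conjgM.
  by cancel_sq; rewrite conjg1.
have a'a : commute (a' ^ c) (a ^ b).
  by apply: shift; move: x8; rewrite 2!(conjgM d') d1c' -conjgM.
have aa' : commute (a ^ c) (a' ^ b).
  (* Conjugating by [a ^ b] fixes [a ^ c] and turns [a' ^ b] into [(a' ^ a) ^ b], which is the form
     reached by the last relation of [four_point_comm]. *)
  apply/(commuteJ _ _ (a ^ b)).
  have -> : (a ^ c) ^ (a ^ b) = a ^ c.
    by apply: conjg_commute; exact: same.
  rewrite -conjJg; apply: shift.
  have -> : (a' ^ a) ^ (b' * c) = d ^ (d' * d * c' * c).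
    rewrite 2!(conjgM d) (conjgM _ b'); congr (_ ^ _).
    have -> : d' * d = d * d1 by rewrite -conjgC.
    rewrite (conjgM d) (conjg_commute (commute_refl d)) (conjJg d) dc' d1c'.
    exact: conjJg.
  exact: y16.
by move=> u v; rewrite !inE => /orP[]/eqP-> /orP[]/eqP-> //; exact: same.
Qed.

Lemma four_point_dE :
  [/\ d = (a' ^ b') ^ c', d1 = (a ^ b') ^ c', d = (a' ^ b) ^ c & d1 = (a ^ b) ^ c].
Proof.
have [E1 E2 E3 E4] := four_pointE.
case: R => _ _ [_ _ _ cd c'd] [_ _ _ cd1 c'd1] _ _.
by rewrite -E1 -E2 -E3 -E4 -!(conjgM _ _ c') -!(conjgM _ _ c) !braid_conj2.
Qed.

Lemma four_point_collapse_bc : b = b' -> c = c'.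
Proof.
have [E1 E2 _ _] := four_pointE.
by move=> bb'; apply: (@conjg_inj _ d); rewrite E1 E2 bb'.
Qed.

Lemma four_point_collapse_ad : a = a' -> d = d'.
Proof.
have [_ _ E1 E2] := four_point_dE => aa'.
have : d1 = d by rewrite [RHS]E1 [LHS]E2 aa'.
by rewrite -{2}(conjg_commute (commute_refl d)) => /conjg_inj.
Qed.

End FourPoint.

(** What remains of (R4) once the two generators of each edge agree. *)
Lemma four_point_single (G : groupType) (a b c d : G) :
  four_point a a b b c c d d ->
  [/\ braid a b, braid d b, braid c d, commute b c & commute a d] /\ c ^ d = a ^ b.
Proof.
move=> R; have [db bc _ _] := four_point_A3 R.
have [_ E _ _] := four_pointE R.
have [ab _ _ cd _] := four_point_braid' R.
have [_ _ bV _] := four_point_involution_ab R.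
have [ad _ _ _] := four_point_comm R.
by split=> //; split=> //; move: ad; rewrite mulg_sq ?conjg1.
Qed.

(* Edges 1, 2, 3, 4 at V_1, together with the edge e = 5 which meets 2 at V_5. *)
Section FourPointTail.
Variables (G : groupType) (a a' b b' c c' d d' e e' : G).
Hypothesis R : four_point a a' b b' c c' d d'.
Hypotheses (b'e : braid b' e) (b'e' : braid b' e') (b'e1 : braid b' (e' ^ e)).
Hypotheses (eV : involution e) (e'V : involution e').
Hypothesis bE : b = b' ^ (e * e').
Hypothesis e_ac : forall u v,
  u \in [:: e; e'] -> v \in [:: a; a'; c; c'] -> commute u v.

Let bV : involution b. Proof. by have [] := four_point_involution_ab R. Qed.
Let b'V : involution b'. Proof. by have [] := four_point_involution_ab R. Qed.
Let aV : involution a. Proof. by have [] := four_point_involution_ab R. Qed.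
Let a'V : involution a'. Proof. by have [] := four_point_involution_ab R. Qed.
Let cV : involution c. Proof. by have [] := four_point_involution_cd R. Qed.
Let c'V : involution c'. Proof. by have [] := four_point_involution_cd R. Qed.

(** By [bE], [b * b'] is a quotient of [e * e'] and its conjugate by [b'], which commute by
    [braid_translation_commute]. So conjugating [b = (b * b') * b'] by [e * e'] only changes the
    last factor, into [b]. *)
Lemma tail_shift : b ^ (e * e') = b' ^ b.
Proof.
pose eps := e * e'.
have h := braid_translation_commute b'V eV e'V b'e b'e' b'e1.
have bb' : b * b' = eps^-1 * eps ^ b'.
  by rewrite [in LHS]bE conjgE [eps ^ _]conj_sq //; cancel_sq.
rewrite -{1}(mulg_sqK b b'V) (conjMg _ b') -bE (conj_sq b' bV); congr (_ * _).
rewrite bb'; apply: conjg_commute.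
apply/commute_sym/commuteM => //; exact/commuteV/commute_refl.
Qed.

(** Conjugation by [e * e'] fixes [c] and [c'], sends [b'] to [b] and, by [tail_shift], [b ^ b'] to
    [b']. *)
Lemma tail_commute_bc : [/\ commute b c, commute b c' & commute b' c'].
Proof.
have [_ b'c _ _] := four_point_A3 R.
have ec v : v \in [:: c; c'] -> v ^ (e * e') = v.
  rewrite !inE => /orP cv; apply/conjg_commute/commute_sym.
  by have [->|->] : v = c \/ v = c' by [case: cv => /eqP; auto];
    apply/commute_sym/commuteM; apply/commute_sym/e_ac; rewrite !inE eqxx ?orbT.
have h := four_point_shifted_commute R.
have b'c' : commute b' c'.
  have -> : b' = (b ^ b') ^ (e * e').
    by rewrite conjJg tail_shift -bE -conjgM mulg_sq ?conjg1.
  by rewrite -(ec c') ?inE ?eqxx ?orbT //; apply/commuteJ.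
by split=> //; rewrite bE; [rewrite -(ec c)|rewrite -(ec c')];
  rewrite ?inE ?eqxx ?orbT //; apply/commuteJ.
Qed.

Lemma tail_collapse_b :
  commute b (e' * e * (d' * d) * (c' * c) * (b' * b) * (a' * a)) -> b = b'.
Proof.
have [bc bc' b'c'] := tail_commute_bc.
have [_ b'c _ _] := four_point_A3 R.
have [dE d1E _ _] := four_point_dE R.
have orth := four_point_commute R bc bc' b'c'.
have [a'c ac] := four_point_braid_ac R bc.
(* [th] and [Th] are opaque, so that products are expanded only where wanted. *)
have [th eth] : exists th, th = a' * a by exists (a' * a).
have [Th eTh] : exists Th, Th = th ^ b by exists (th ^ b).
have D : d' * d = (th ^ b') ^ c'.
  by rewrite eth conjgC (conjMg a') (conjMg _ _ c') -dE -d1E.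
have be' : braid b e'.
  have -> : e' = (e' ^ e) ^ (e * e').
    by rewrite -conjgM; cancel_sq; rewrite conjg_commute.
  by rewrite bE; apply/braidJ.
have th_e' : commute e' th.
  by rewrite eth; apply: commuteM; apply: e_ac; rewrite !inE eqxx ?orbT.
have e'c : commute e' c by apply: e_ac; rewrite !inE eqxx ?orbT.
have [a'b _ _ _ _] := four_point_braid' R.
have [ab _ _ _ _] := four_point_braid R.
have ThV : Th^-1 = b * th^-1 * b by rewrite eTh -conj_sq // conjVg.
have F1 : commute c (Th * th^-1).
  have -> : Th * th^-1 = b * (a ^ b) ^ a'.
    by rewrite eTh eth !conj_sq // invgM aV a'V; cancel_sq; rewrite (braidr _ ab).
  apply: commuteM; first exact: commute_sym.
  apply/(commuteJ _ _ a'); rewrite -conjgM mulg_sq // conjg1 -braid_conj //.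
  by apply: orth; rewrite !inE eqxx ?orbT.
have F2 : commute c (Th^-1 * th).
  have -> : Th^-1 * th = b * (a' ^ b) ^ a.
    by rewrite ThV eth !conj_sq // invgM aV a'V; cancel_sq; rewrite (braidr _ a'b).
  apply: commuteM; first exact: commute_sym.
  apply/(commuteJ _ _ a); rewrite -conjgM mulg_sq // conjg1 -braid_conj //.
  by apply: orth; rewrite !inE eqxx ?orbT.
have F3 : commute (th ^ c) Th.
  rewrite eTh eth (conjMg a' a b) (conjMg a' a c).
  apply: commuteM; apply: commute_sym; apply: commuteM; apply: commute_sym;
    by apply: orth; rewrite !inE eqxx ?orbT.
rewrite D -eth => U.
have be : b * e' * e = e' * e * b'.
  by rewrite bE conjgE invgM eV e'V; cancel_sq.
(* Cancelling [e' * e * c'] in [U] makes [b * b'] the commutator of [Th] and [th]. *)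
have E : b * b' = Th * th * Th^-1 * th^-1.
  have E1 : th * c * b * th = b' * th * c * b * th * b.
    apply: (@mulgI _ (e' * e * c')).
    move: U; rewrite /commute !conj_sq //; cancel_sq; rewrite be.
    by rewrite !(commuter _ b'c') !(commuter _ b'c); cancel_sq => ->.
  have E2 : c * (Th * th^-1) * b * c = Th * th^-1 * b.
    by rewrite F1 -(mulgA _ b) bc; cancel_sq.
  have -> : b' = th * (c * (Th * th^-1) * b * c) * th^-1.
    apply: (@mulIg _ (th * c * b * th * b)); rewrite !mulgA -E1 eTh conj_sq //.
    by cancel_sq; rewrite mulgVK; cancel_sq; rewrite mulgVK; cancel_sq.
  by rewrite E2 ThV eTh conj_sq //; cancel_sq.
have F4 : commute (b ^ e') Th.
  by rewrite eTh (braid_conj bV e'V be'); apply/commuteJ.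
have F5 : commute (b ^ e') (Th ^ c).
  have <- : (b ^ e') ^ c = b ^ e'.
    apply/conjg_commute; rewrite conj_sq //.
    by apply/commute_sym; do 2?apply: commuteM; exact: commute_sym.
  exact/commuteJ.
(* By F2 and F3, th can be eliminated from E. *)
have thE : th = Th * (Th ^ c)^-1 * th ^ c.
  by rewrite -mulgA -conjVg -conjMg (conjg_commute (commute_sym F2)) mulKVg.
have : commute (b ^ e') (b * b').
  have -> : b * b' = Th * Th * (Th ^ c)^-1 * Th^-1 * Th ^ c * Th^-1.
    rewrite E {1 2}thE; move: (Th ^ c) (th ^ c) F3 => w v vTh.
    rewrite !invgM invgK !mulgA -(mulgA _ v) (commuteV vTh); cancel_sq.
    by rewrite mulgK.
  by do ?apply: commuteM => //; apply: commuteV.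
(* Writing [b ^ e'] as [e' ^ b] on one side only leaves [e' * b' = b' * e' * b * e']; the braid
   relation of [b'] and [e'] then gives [b = b']. *)
rewrite /commute {1}(braid_conj bV e'V be') !conj_sq //; cancel_sq.
rewrite -!(mulgA b) => /mulgI bb'; apply/esym/(@mulgI _ (b' * e')).
by rewrite b'e' bb'; cancel_sq.
Qed.

(** By [bE], [b] commutes with [e * e']; but the conjugate of [e * e'] by [b] is the square of the
    involution [b ^ e]. *)
Lemma tail_collapse_e : b = b' -> e = e'.
Proof.
move=> bb'; move: bE b'e b'e'; rewrite -bb' => bE1 be be'.
have be_e' : b ^ e = b ^ e' by rewrite [in RHS]bE1 -conjgM mulg_sqK.
have : (e * e') ^ b = e * e'.
  by apply/conjg_commute/commute_sym; rewrite /commute conjgC -bE1.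
rewrite conjMg -(braid_conj bV eV be) -(braid_conj bV e'V be') be_e'.
rewrite -conjMg mulg_sq // conj1g => /esym ee'.
by rewrite -[e](mulg_sqK _ e'V) ee' mul1g.
Qed.

End FourPointTail.

(** * The relations at a vertex with three edges *)

Record three_point (G : groupType) (a a' b b' c c' : G) : Prop := {
  three_point_involution_a : involution a /\ involution a';
  three_point_involution_bc :
    [/\ involution b, involution b', involution c & involution c'];
  three_point_braid :
    [/\ braid a' b, braid a' b', braid a' (b' ^ b) & braid c (b ^ (a' * b * b'))];
  three_point_a : a = a' ^ (b * b');
  three_point_c : c' = c * b' * b * a' * b' * b * a' * b * b' * c * b' * b * a'
    * b * b' * a' * b * b' * c;
  three_point_commute : commute a c /\ commute a c' }.

(** All factors [b * b'] vanish, and conjugation by [a], which commutes with [c], carries the braid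
    relation of [c] with [b ^ a] to one with [b]. *)
Lemma three_point_collapse (G : groupType) (a a' b b' c c' : G) :
  three_point a a' b b' c c' -> b = b' ->
  [/\ a = a', c = c', braid a b & braid c b].
Proof.
case=> -[aV a'V] [bV b'V cV c'V] [a'b _ _ cb] aE cE [ac _] bb'.
have aa' : a = a' by rewrite aE -bb' mulg_sq ?conjg1.
split=> //; first by rewrite cE -bb'; cancel_sq.
  by rewrite aa'.
apply/(braidJ _ _ a); rewrite (conjg_commute (commute_sym ac)).
rewrite -[a in b ^ a](_ : a' * b * b' = _) //.
by rewrite -bb' aa' mulg_sqK.
Qed.

(** * Coxeter groups of type A *)

Lemma morph_mulg1 (G H : groupType) (phi : G -> H) :
  {morph phi : x y / x * y} -> phi 1 = 1.
Proof. by move=> phiM; apply: (@mulgI _ (phi 1)); rewrite -phiM !mulg1. Qed.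

Section CoxeterGroup.
Variables (G : groupType) (n : nat) (s : nat -> G).
Hypothesis sV : forall i, i < n -> involution (s i).
Hypothesis s_braid : forall i, i.+1 < n -> braid (s i) (s i.+1).
Hypothesis s_commute : forall i j, i.+1 < j -> j < n -> commute (s i) (s j).

(** Products without inverses form a subgroup, since the [s i] are involutions. *)
Inductive generated (k : nat) : G -> Prop :=
| generated_1 : generated k 1
| generated_s i x : k <= i < n -> generated k x -> generated k (s i * x).

Lemma generatedM k x y : generated k x -> generated k y -> generated k (x * y).
Proof.
elim=> [|i u ki _ IH] gy; rewrite ?mul1g // -mulgA.
by apply: generated_s => //; apply: IH.
Qed.

Lemma generated_gen k i : k <= i < n -> generated k (s i).
Proof. by move=> ki; rewrite -[s i]mulg1; apply/generated_s/generated_1. Qed.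

(** The letters descend from [s (k + m - 1)] to [s k]: these are the coset representatives of the
    normal form. *)
Fixpoint chain (k m : nat) : G :=
  if m is m'.+1 then s (k + m') * chain k m' else 1.

Lemma chain_commute k m i : k + m < i -> i < n -> commute (s i) (chain k m).
Proof.
elim: m => [|m IH] kmi iltn /=; first exact: commute1.
apply: commuteM; last by apply: IH => //; apply: leq_ltn_trans kmi; rewrite leq_add2l.
by apply/commute_sym/s_commute => //; rewrite -addnS.
Qed.

Lemma chain_shift k m i : k <= i -> i.+1 < k + m -> k + m <= n ->
  s i * chain k m = chain k m * s i.+1.
Proof.
elim: m => [|m IH] ki; first by rewrite addn0 => /ltnW/leq_trans/(_ ki); rewrite ltnn.
rewrite addnS ltnS leq_eqVlt => /orP[/eqP im|im] kmn /=.
  case: m im {IH} kmn => [|m] im kmn; first by move: ki; rewrite -[k]addn0 -im ltnn.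
  move: im; rewrite addnS => -[im] /=; move: kmn; rewrite !addnS -im => kmn.
  rewrite !mulgA (s_braid (i := i)) // -!mulgA; congr (_ * (_ * _)).
  by rewrite chain_commute // im.
rewrite mulgA (s_commute im) // -!mulgA IH // ltnW //.
Qed.

(** A letter [s i] put in front of the chain moves through it as [s i.+1] if [i.+1 < k + m], cancels
    its first letter if [i.+1 = k + m], lengthens it if [i = k + m], and commutes with it beyond. *)
Lemma generated_normal_form k x : k <= n -> generated k x ->
  exists m h, [/\ k + m <= n, generated k.+1 h & x = chain k m * h].
Proof.
move=> kn; elim=> [|i u /andP[ki iltn] _ [m [h [kmn gh ->]]]].
  by exists 0, 1; rewrite addn0 mul1g; split=> //; exact: generated_1.
have [im|im|im] := ltngtP i.+1 (k + m).
- exists m, (s i.+1 * h); split=> //; last by rewrite mulgA chain_shift // mulgA.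
  by apply: generated_s => //; rewrite ltnS ki (leq_trans im).
- have [im'|im'|im'] := ltngtP i (k + m).
  + by move: im; rewrite ltnS leqNgt im'.
  + exists m, (s i * h); split=> //; last by rewrite !mulgA chain_commute.
    by apply: generated_s => //; rewrite iltn andbT (leq_ltn_trans (leq_addr m k)).
  + exists m.+1, h; split=> //; first by rewrite addnS -im'.
    by rewrite /= -im' mulgA.
- case: m im kmn => [|m] im kmn; first by move: ki; rewrite -[k]addn0 -im ltnn.
  exists m, h; split=> //; first by apply: leq_trans kmn; rewrite leq_add2l.
  move: im; rewrite addnS => -[im] /=.
  by rewrite !mulgA -im mulg_sq ?mul1g //; apply: sV.
Qed.

Variables (T : finType) (p : nat -> T) (theta : G -> {perm T}).
Hypothesis p_inj : {in [pred i | i <= n] &, injective p}.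
Hypothesis thetaM : {morph theta : x y / x * y}.
Hypothesis theta_s : forall i, i < n -> theta (s i) = tperm (p i) (p i.+1).

Let theta1 : theta 1 = 1. Proof. exact: morph_mulg1. Qed.

Lemma theta_chain k m : k + m <= n -> theta (chain k m) (p (k + m)) = p k.
Proof.
elim: m => [|m IH] kmn /=; first by rewrite theta1 perm1 addn0.
by rewrite addnS in kmn *; rewrite thetaM permM theta_s // tpermR IH // ltnW.
Qed.

Lemma theta_fix k x : k < n -> generated k.+1 x -> theta x (p k) = p k.
Proof.
move=> kn; elim=> [|i u /andP[ki iltn] _ IH]; first by rewrite theta1 perm1.
rewrite thetaM permM theta_s // tpermD //; apply/eqP => /p_inj.
  by rewrite !inE => /(_ (ltnW iltn) (ltnW kn)) ik; rewrite ik ltnn in ki.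
by rewrite !inE => /(_ iltn (ltnW kn)) ik; move: ki; rewrite -ik ltnNge leqnSn.
Qed.

(** Permutations compose from left to right: the chain sends [p (k + m)] to [p k], which [h] fixes.
    So [theta x = 1] forces [m = 0], and [k] can be increased. *)
Lemma theta_injective x : generated 0 x -> theta x = 1 -> x = 1.
Proof.
suff gen k : k <= n -> generated k x -> theta x = 1 -> x = 1 by exact: gen.
move: {2}(n - k) (erefl (n - k)) => j; elim: j k => [|j IH] k.
  move=> /eqP; rewrite subn_eq0 => nk kn [//|i u /andP[ki iltn]].
  by move: (leq_trans iltn nk); rewrite ltnNge ki.
move=> nk kn gx x1; have kltn : k < n by rewrite -subn_gt0 nk.
apply: (IH k.+1) => //; first by rewrite subnS nk.
have [m [h [kmn gh xE]]] := generated_normal_form kn gx.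
suff m0 : m = 0 by rewrite xE m0 mul1g.
have := congr1 (fun t : {perm T} => t (p (k + m))) x1.
rewrite /= perm1 xE thetaM permM theta_chain // theta_fix // => /p_inj.
by rewrite !inE => /(_ kn kmn)/eqP; rewrite -{1}[k]addn0 eqn_add2l => /eqP.
Qed.

End CoxeterGroup.

(** * The group of the complement of the branch curve *)

Section Evaluation.
Variables (G : groupType) (f : gen -> G).
Implicit Types u v : word gen.
Local Notation ev := (weval f).

Lemma weval_cat u v : ev (u ++ v) = ev u * ev v.
Proof. exact: big_cat. Qed.

Lemma weval_winv u : ev (winv u) = (ev u)^-1.
Proof.
elim: u => [|[x e] u IH]; first by rewrite /weval !big_nil invg1.
rewrite /winv /= rev_cons -cats1 weval_cat [weval _ _]IH /weval !big_cons big_nil.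
rewrite mulg1 invgM.
by congr (_ * _); case: e; rewrite /= ?invgK.
Qed.

Lemma weval_gam i : ev (gam i) = f (inord i.-1, false).
Proof. by rewrite /weval big_cons big_nil mulg1. Qed.

Lemma weval_gam' i : ev (gam' i) = f (inord i.-1, true).
Proof. by rewrite /weval big_cons big_nil mulg1. Qed.

Definition wevalE := (weval_cat, weval_winv, weval_gam, weval_gam').

Lemma weval_comm u v : ev (Defs.comm u v) = 1 -> commute (ev u) (ev v).
Proof. by rewrite /Defs.comm !wevalE => /commute_comm. Qed.

Lemma weval_triple u v : ev (Defs.triple u v) = 1 -> braid (ev u) (ev v).
Proof. by rewrite /Defs.triple !wevalE => /braid_triple. Qed.

Lemma weval_eqn u v : ev (Defs.eqn u v) = 1 -> ev u = ev v.
Proof. by rewrite /Defs.eqn !wevalE => /eq_div. Qed.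

Hypothesis fV : forall x, involution (f x).
Local Notation g i := (f (inord i.-1, false)).
Local Notation g' i := (f (inord i.-1, true)).

Ltac flatten_words := rewrite ?wevalE ?conjgE ?invgM ?fV ?mulgA.

(** The numbers are positions in the list [R4]. As generators are involutions, a relation and its
    field in [four_point] flatten to the same words. *)
Lemma R4_four_point i j k l : {in R4 i j k l, forall r, ev r = 1} ->
  four_point (g i) (g' i) (g j) (g' j) (g k) (g' k) (g l) (g' l).
Proof.
move=> H; have h n : n < 20 -> ev (nth [::] (R4 i j k l) n) = 1.
  by move=> n20; apply: H; apply: mem_nth.
split; try by split.
- split.
  + by have := weval_triple (h 0 isT); flatten_words.
  + by have := weval_triple (h 1%N isT); flatten_words.
  + by have := weval_triple (h 2 isT); flatten_words.
  + by have := weval_triple (h 3 isT); flatten_words.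
  + by have := weval_triple (h 4 isT); flatten_words.
- split.
  + by have := weval_triple (h 8 isT); flatten_words.
  + by have := weval_triple (h 9 isT); flatten_words.
  + by have := weval_triple (h 10 isT); flatten_words.
  + by have := weval_triple (h 11 isT); flatten_words.
  + by have := weval_triple (h 12 isT); flatten_words.
- split.
  + by have := weval_comm (h 6 isT); flatten_words.
  + by have := weval_comm (h 7 isT); flatten_words.
  + by have := weval_comm (h 14 isT); flatten_words.
  + by have := weval_comm (h 15 isT); flatten_words.
- split.
  + by have := weval_eqn (h 16 isT); flatten_words.
  + by have := weval_eqn (h 17 isT); flatten_words.
  + by have := weval_eqn (h 18 isT); flatten_words.
  + by have := weval_eqn (h 19 isT); flatten_words.
Qed.

Lemma R3_three_point i j k : {in R3 i j k, forall r, ev r = 1} ->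
  three_point (g i) (g' i) (g j) (g' j) (g k) (g' k).
Proof.
move=> H; have h n : n < 12 -> ev (nth [::] (R3 i j k) n) = 1.
  by move=> n12; apply: H; apply: mem_nth.
split; try by split.
- split.
  + by have := weval_triple (h 0 isT); flatten_words.
  + by have := weval_triple (h 1%N isT); flatten_words.
  + by have := weval_triple (h 2 isT); flatten_words.
  + by have := weval_triple (h 4 isT); flatten_words.
- by have := weval_eqn (h 3 isT); flatten_words.
- by have := weval_eqn (h 7 isT); flatten_words.
- split.
  + by have := weval_comm (h 8 isT); flatten_words.
  + by have := weval_comm (h 9 isT); flatten_words.
Qed.

End Evaluation.

Lemma mem_catl (T : eqType) (x : T) (s t : seq T) : x \in s -> x \in s ++ t.
Proof. by rewrite mem_cat => ->. Qed.

Lemma mem_catr (T : eqType) (x : T) (s t : seq T) : x \in t -> x \in s ++ t.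
Proof. by rewrite mem_cat orbC => ->. Qed.

(** * The relations of the shadow and the equality of the two generators of each edge *)

Section X3Group.
Variables (G : groupType) (f : gen -> G).
Hypothesis fV : forall x, involution (f x).
Hypothesis fR : forall r, X3_relators r -> weval f r = 1.
Local Notation g i := (f (inord i.-1, false)).
Local Notation g' i := (f (inord i.-1, true)).

Lemma X3_V1 : four_point (g 1) (g' 1) (g 2) (g' 2) (g 3) (g' 3) (g 4) (g' 4).
Proof. by apply: R4_four_point => // r rR; apply: fR; exact: mem_catl. Qed.

Lemma X3_V2 : four_point (g 3) (g' 3) (g 6) (g' 6) (g 8) (g' 8) (g 10) (g' 10).
Proof.
by apply: R4_four_point => // r rR; apply: fR; apply: mem_catr; exact: mem_catl.
Qed.

Lemma X3_V3 : four_point (g 4) (g' 4) (g 5) (g' 5) (g 6) (g' 6) (g 7) (g' 7).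
Proof.
by apply: R4_four_point => // r rR; apply: fR; do 2!apply: mem_catr; exact: mem_catl.
Qed.

Lemma X3_V4 : four_point (g 7) (g' 7) (g 9) (g' 9) (g 10) (g' 10) (g 11) (g' 11).
Proof.
by apply: R4_four_point => // r rR; apply: fR; do 3!apply: mem_catr; exact: mem_catl.
Qed.

Lemma X3_V5 : three_point (g 2) (g' 2) (g 5) (g' 5) (g 9) (g' 9).
Proof.
by apply: R3_three_point => // r rR; apply: fR; do 4!apply: mem_catr; exact: mem_catl.
Qed.

Lemma X3_V6 : three_point (g 1) (g' 1) (g 8) (g' 8) (g 11) (g' 11).
Proof.
by apply: R3_three_point => // r rR; apply: fR; do 5!apply: mem_catr; exact: mem_catl.
Qed.

Lemma X3_disjoint i j p q : (i, j) \in disjoint_edges ->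
  commute (f (inord i.-1, p)) (f (inord j.-1, q)).
Proof.
move=> ij; have h n : (n < 4)%N -> weval f (nth [::] (R5 i j) n) = 1.
  move=> n4; apply: fR; do 6!apply: mem_catr; apply/mem_catl/flattenP.
  by exists (R5 i j); [apply/mapP; exists (i, j)|apply: mem_nth].
case: p q => -[].
- by have := weval_comm (h 3 isT); rewrite !wevalE.
- by have := weval_comm (h 2 isT); rewrite !wevalE.
- by have := weval_comm (h 1%N isT); rewrite !wevalE.
- by have := weval_comm (h 0 isT); rewrite !wevalE.
Qed.

Lemma X3_RP : g' 11 * g 11 * (g' 10 * g 10) * (g' 9 * g 9) * (g' 8 * g 8) *
  (g' 7 * g 7) * (g' 6 * g 6) *
  (g' 5 * g 5 * (g' 4 * g 4) * (g' 3 * g 3) * (g' 2 * g 2) * (g' 1 * g 1)) = 1.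
Proof.
rewrite -(fR (_ : X3_relators RP)); last first.
  by do 7!apply: mem_catr; rewrite mem_seq1.
rewrite /RP (_ : rev (iota 1 11) = [:: 11; 10; 9; 8; 7; 6; 5; 4; 3; 2; 1]%N) //=.
by rewrite /weval !big_cons big_nil mulg1 /= !mulgA.
Qed.

Lemma X3_edge2 : g 2 = g' 2 /\ g 5 = g' 5.
Proof.
have [[a'b a'b' a'b1 _] bE] := (three_point_braid X3_V5, three_point_a X3_V5).
have e_ac u v : u \in [:: g 5; g' 5] -> v \in [:: g 1; g' 1; g 3; g' 3] ->
    commute u v.
  by rewrite !inE => /orP[]/eqP-> /or4P[]/eqP->; apply/commute_sym/X3_disjoint.
suff E : g 2 = g' 2.
  by split=> //; apply: (tail_collapse_e X3_V1 a'b a'b' _ _ bE E).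
apply: (tail_collapse_b X3_V1 a'b a'b' a'b1 _ _ bE e_ac) => //.
(* [W] collects the edges 11 to 6. Edge 9 meets edge 2 at V_5, where (R3) makes them commute; the
   others are disjoint from edge 2. *)
have := X3_RP; set W := (X in X * _); move/mulg1_eq => <-; apply: commuteV.
have [a9 a9'] := three_point_commute X3_V5.
by rewrite /W; do !apply: commuteM => //; apply: X3_disjoint.
Qed.

Lemma X3_sheets i : (0 < i <= 11)%N -> g i = g' i.
Proof.
have [E2 E5] := X3_edge2.
have [_ E9 _ _] := three_point_collapse X3_V5 E5.
have E3 := four_point_collapse_bc X3_V1 E2.
have E6 := four_point_collapse_bc X3_V3 E5.
have E10 := four_point_collapse_bc X3_V4 E9.
have E8 := four_point_collapse_bc X3_V2 E6.
have [E1 E11 _ _] := three_point_collapse X3_V6 E8.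
have E4 := four_point_collapse_ad X3_V1 E1.
have E7 := four_point_collapse_ad X3_V3 E4.
by do 12![case: i => [|i] //].
Qed.

End X3Group.

(** * Coxeter generators along a path of triangles *)

Section X3Coxeter.
Variables (G : groupType) (f : gen -> G).
Hypothesis fV : forall x, involution (f x).
Hypothesis fR : forall r, X3_relators r -> weval f r = 1.
Local Notation g i := (f (inord i.-1, false)).

(* The edges crossed by the path 0, 1, 4, 5, 6, 7, 2, 3 through the triangles. *)
Definition X3_path (k : nat) : nat := nth 0%N [:: 2; 5; 9; 11; 10; 6; 3]%N k.
Definition X3_path_triangle (k : nat) : 'I_(ntri X3) :=
  inord (nth 0%N [:: 0; 1; 4; 5; 6; 7; 2; 3]%N k).
Definition X3_coxeter (k : nat) : G := g (X3_path k).

Let V1 : four_point (g 1) (g 1) (g 2) (g 2) (g 3) (g 3) (g 4) (g 4).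
Proof. by have := X3_V1 fV fR; rewrite -!X3_sheets. Qed.

Let V2 : four_point (g 3) (g 3) (g 6) (g 6) (g 8) (g 8) (g 10) (g 10).
Proof. by have := X3_V2 fV fR; rewrite -!X3_sheets. Qed.

Let V3 : four_point (g 4) (g 4) (g 5) (g 5) (g 6) (g 6) (g 7) (g 7).
Proof. by have := X3_V3 fV fR; rewrite -!X3_sheets. Qed.

Let V4 : four_point (g 7) (g 7) (g 9) (g 9) (g 10) (g 10) (g 11) (g 11).
Proof. by have := X3_V4 fV fR; rewrite -!X3_sheets. Qed.

Lemma X3_coxeter_braid i : (i.+1 < 7)%N -> braid (X3_coxeter i) (X3_coxeter i.+1).
Proof.
have [_ E5] := X3_edge2 fV fR.
have [_ _ b25 b95] := three_point_collapse (X3_V5 fV fR) E5.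
have [[b36 b106 _ _ _] _] := four_point_single V2.
have [[_ b119 b1011 _ _] _] := four_point_single V4.
by do 6?[case: i => [|i] //].
Qed.

(** Nonconsecutive edges of the path are disjoint, except 2 and 9, 2 and 3, 3 and 10, 5 and 6, 9 and
    10, which commute by the relations at their common vertex. *)
Lemma X3_coxeter_commute i j : (i.+1 < j)%N -> (j < 7)%N ->
  commute (X3_coxeter i) (X3_coxeter j).
Proof.
have [c29 _] := three_point_commute (X3_V5 fV fR).
have [[_ _ _ c23 _] _] := four_point_single V1.
have [[_ _ _ _ c310] _] := four_point_single V2.
have [[_ _ _ c56 _] _] := four_point_single V3.
have [[_ _ _ c910 _] _] := four_point_single V4.
have dis k l : ((k, l) \in disjoint_edges) || ((l, k) \in disjoint_edges) ->
    commute (g k) (g l).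
  by case/orP => kl; [|apply: commute_sym]; apply: X3_disjoint.
do 6?[case: i => [|i] //]; do 8?[case: j => [|j] //]; move=> _ _;
  by [apply: dis | apply: commute_sym].
Qed.

(** The edges 8, 7, 4, 1 off the path are recovered in this order from [c ^ d = a ^ b] at V_2, V_4,
    V_3, V_1. *)
Lemma X3_generated x : generated 7 X3_coxeter 0 (f x).
Proof.
have gM := @generatedM _ 7 X3_coxeter 0.
have gJ u v : involution v -> generated 7 X3_coxeter 0 u ->
    generated 7 X3_coxeter 0 v -> generated 7 X3_coxeter 0 (u ^ v).
  by move=> vV gu gv; rewrite conj_sq //; exact: gM _ _ (gM _ _ gv gu) gv.
have gs k : (k < 7)%N -> generated 7 X3_coxeter 0 (X3_coxeter k).
  by move=> k7; apply: generated_gen; rewrite leq0n.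
have solve (a b z : G) : z = a ^ b -> involution b -> a = z ^ b.
  by move=> -> bV; rewrite -conjgM mulg_sq ?conjg1.
have g2 := gs 0 isT; have g5 := gs 1%N isT; have g9 := gs 2 isT.
have g11 := gs 3 isT; have g10 := gs 4 isT; have g6 := gs 5 isT; have g3 := gs 6 isT.
have g8 : generated 7 X3_coxeter 0 (g 8).
  have [_ E] := four_point_single V2.
  by rewrite (solve _ _ _ (esym E)) //; do ?apply/gJ.
have g7 : generated 7 X3_coxeter 0 (g 7).
  have [_ E] := four_point_single V4.
  by rewrite (solve _ _ _ E) //; do ?apply/gJ.
have g4 : generated 7 X3_coxeter 0 (g 4).
  have [_ E] := four_point_single V3.
  by rewrite (solve _ _ _ E) //; do ?apply/gJ.
have g1 : generated 7 X3_coxeter 0 (g 1).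
  have [_ E] := four_point_single V1.
  by rewrite (solve _ _ _ E) //; do ?apply/gJ.
have gE i : (0 < i <= 11)%N -> generated 7 X3_coxeter 0 (g i).
  by do 12![case: i => [|i] //].
have eE (e : 'I_11) : e = inord e.+1.-1 by rewrite inord_val.
case: x => e p; have e11 : (0 < e.+1 <= 11)%N by exact: ltn_ord.
by case: p; rewrite [X in f (X, _)]eE -?(X3_sheets fV fR e11); exact: gE.
Qed.

End X3Coxeter.

(** * Application to the exact sequence of the Galois cover *)

Lemma weval_morph (G H : groupType) (phi : G -> H) (gamma : gen -> G) (w : word gen) :
  {morph phi : x y / x * y} -> phi (weval gamma w) = weval (phi \o gamma) w.
Proof.
move=> phiM; have phi1 := morph_mulg1 phiM.
elim: w => [|[x e] w IH]; first by rewrite /weval !big_nil.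
rewrite /weval !big_cons phiM -/(weval _ _) IH; congr (_ * _).
by case: e => //=; apply/esym/mulg1_eq; rewrite -phiM mulgV.
Qed.

(** Reduces [shares] to a computation on lists of numbers. *)
Lemma X3_shares (e : 'I_(nedge X3)) (i j : 'I_(ntri X3)) : i != j ->
  all (mem (nth [::] X3_triangles i)) (nth [::] X3_edges e) ->
  all (mem (nth [::] X3_triangles j)) (nth [::] X3_edges e) ->
  shares e i j.
Proof.
move=> ij /allP ei /allP ej; apply/and3P; split=> //; apply/fintype.subsetP => a.
  by rewrite !inE => /ei.
by rewrite !inE => /ej.
Qed.

Lemma X3_path_triangle_inj : {in [pred k | (k <= 7)%N] &, injective X3_path_triangle}.
Proof.
have ub k : (nth 0 [:: 0; 1; 4; 5; 6; 7; 2; 3] k < 8)%N.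
  by do 8?[case: k => [|k] //]; rewrite nth_default.
move=> k l; rewrite !inE => k7 l7 /(congr1 val); rewrite /= !inordK //.
by move/eqP; rewrite nth_uniq // => /eqP.
Qed.

Lemma X3_path_shares k : (k < 7)%N ->
  shares (inord (X3_path k).-1 : 'I_(nedge X3))
    (X3_path_triangle k) (X3_path_triangle k.+1).
Proof.
move=> k7; apply: X3_shares; rewrite -?val_eqE /= !inordK;
  by do 7?[case: k k7 => [|k] // k7].
Qed.

Lemma X3_exact_sequence_trivial (P G : groupType) (gamma : gen -> G) :
  presented_by gamma X3_relators -> galois_exact_sequence X3 P gamma ->
  forall c : P, c = 1.
Proof.
move=> [gammaS gammaR] [iota [theta [[iotaM thetaM] iota_inj iotaK _ theta_gamma]]] c.
pose Q := quot_ncl (range (fun x => gamma x * gamma x)).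
pose q : G -> Q := @to_quot _ _.
have qM : {morph q : x y / x * y} by exact: to_quotM.
pose f := q \o gamma.
have fV x : involution (f x).
  apply: involutionP; rewrite /f /= -qM -[RHS](morph_mulg1 qM); apply/esym.
  by apply: Defs.to_quotP; rewrite invg1 mul1g; apply: ncl_in; exists x.
have fR r : X3_relators r -> weval f r = 1.
  move=> rR; rewrite -weval_morph // -[RHS](morph_mulg1 qM).
  by have /gammaR -> := weq_rel rR; rewrite /weval big_nil.
have gen0 x : generated 7 (X3_coxeter f) 0 x.
  elim/quotW: x => x; have [w <-] := gammaS x; rewrite -/(to_quot _ _) -/(q _).
  rewrite weval_morph //; elim: w => [|[y e] w IH].
    by rewrite /weval big_nil; exact: generated_1.
  rewrite /weval big_cons; apply: generatedM => //=.
  by rewrite fV if_same; apply: X3_generated.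
(* By exactness [iota c] lies in the kernel of [theta], which the Coxeter relations show to be
   trivial. *)
apply: iota_inj; rewrite (morph_mulg1 iotaM).
have : range iota (iota c) by exists c.
rewrite iotaK /=.
apply: (@theta_injective _ 7 (X3_coxeter f) _ _ _ _ X3_path_triangle theta) => //.
- by move=> k _; exact: fV.
- exact: X3_coxeter_braid.
- exact: X3_coxeter_commute.
- exact: X3_path_triangle_inj.
- by move=> k k7; apply/theta_gamma/X3_path_shares.
Qed.

Unset Implicit Arguments.

Local Open Scope classical_set_scope.
Local Open Scope ring_scope.

Theorem theorem3p3 (R : realType) (n : nat) (X : set (CP R n))
  (hX : projective_surface X) (hX8 : has_degree X 8)
  (hdegen : exists p : 'M[Cplx R]_(n.+1, 3),
     generic_projection X p /\ projective_degeneration X3 X p)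
  (M : 'M[Cplx R]_(n.+1, 3)) (hM : generic_projection X M)
  (y0 : ~` branch_curve X M) (gamma : 'I_11 * bool -> pi1 R y0)
  (hG : presented_by gamma X3_relators)
  (x0 : galois_cover X M 8)
  (hexact : galois_exact_sequence X3 (pi1 R x0) gamma) :
  forall c : pi1 R x0, c = 1%g.
Proof.
by apply: (@X3_exact_sequence_trivial (pi1 R x0) (pi1 R y0) gamma).
Qed.
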